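(* Let $K$ be a semiring with $0_K\neq 1_K$, let $A$ be an alphabet, and let $\equiv$ be a finitely generated congruence on $A^*$ which is $K$-shuffle compatible. Then: 1. If $K$ is not a ring, or if $K$ is a ring whose characteristic is not a prime number (characteristic $0$ included), then $A^*/_\equiv$ is a partially commutative monoid, i.e. it is isomorphic to $\mathbb M(B,\theta)$ for some alphabet $B$ and some symmetric irreflexive relation $\theta\subseteq B\times B$. 2. If $K$ is a ring of prime characteristic $p$, then there exist a finite set $R\subset A^*\times A^*$ generating $\equiv$ (that is, $\equiv\;=\;\equiv_R$) and a partition $R=\bigcup_{i\in[1,n]}R_i$ such that for every $i\in[1,n]$, the congruence $\equiv_{\bigcup_{j=1}^{i-1}R_j}$ is $K$-shuffle compatible and, for every pair $(u,v)\in R_i$, the image of $u-v$ is primitive in $K[A^*/_{\equiv_{\bigcup_{j=1}^{i-1}R_j}}]$.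
   Context: $A^*$ is the free monoid on the alphabet (set) $A$, with empty word $1$. A congruence on $A^*$ is an equivalence relation compatible with concatenation on both sides. For $R\subseteq A^*\times A^*$, $\equiv_R$ is the congruence generated by $R$; a congruence is finitely generated if it equals $\equiv_R$ for some finite $R$. Semirings have $0$ and $1$; a ring is a semiring whose addition is a group. For a monoid $M$, $K[M]$ is the monoid algebra (finitely supported functions $M\to K$, scalars commuting with elements of $M$), and $K\langle A\rangle=K[A^*]$. The tensor product $K[M]\otimes K[M]$ is the algebra with $K$-basis $\{m\otimes m' : m,m'\in M\}$ and product $(m\otimes m')(n\otimes n')=mn\otimes m'n'$, i.e. $K[M\times M]$. The coproduct $c:K\langle A\rangle\to K\langle A\rangle\otimes K\langle A\rangle$ dual to the shuffle product is the $K$-linear multiplicative map with $c(1)=1\otimes 1$ and $c(a)=a\otimes 1+1\otimes a$ for $a\in A$. Let $nat:K\langle A\rangle\to K[A^*/_\equiv]$ be the linear extension of the quotient map. The congruence $\equiv$ is called $K$-shuffle compatible if there is a $K$-linear map $c_\equiv:K[A^*/_\equiv]\to K[A^*/_\equiv]\otimes K[A^*/_\equiv]$ with $c_\equiv\circ nat=(nat\otimes nat)\circ c$; equivalently, $u\equiv v$ implies $(nat\otimes nat)(c(u))=(nat\otimes nat)(c(v))$. If $K$ is a ring and $\equiv$ is $K$-shuffle compatible, $P\in K[A^*/_\equiv]$ is primitive if $c_\equiv(P)=P\otimes 1+1\otimes P$. For a symmetric irreflexive relation $\theta\subseteq B\times B$, $\mathbb M(B,\theta)$ is the monoid presented by generators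 $B$ and relations $ab=ba$ for $(a,b)\in\theta$. *)

(* Defs.v *)
From HB Require Import structures.
From mathcomp Require Import all_boot all_algebra finmap.
From mathcomp.classical Require Import boolp.

Set Implicit Arguments.
Unset Strict Implicit.
Unset Printing Implicit Defensive.

Import GRing.Theory.
Local Open Scope ring_scope.
Local Open Scope quotient_scope.

(* The algebra K[M] of a monoid M over a semiring K.  K is not assumed        *)
(* commutative: scalars act on the left, and they commute with M because      *)
(* (a [m]) * (b [n]) = (a b) [m n].                                           *)
Definition malg (K : nzSemiRingType) (M : choiceType) := {fsfun M -> K with 0}.

Section FreeModule.
Variables (K : nzSemiRingType) (M : choiceType).
Implicit Types (P Q : malg K M) (a b : K) (m : M).

HB.instance Definition _ := Choice.on (malg K M).

Definition malg_coef (m : M) (P : malg K M) : K :=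
  (P : {fsfun M -> K with 0}) m.
Definition malg_supp P : {fset M} := finsupp (P : {fsfun M -> K with 0}).

Definition malg_zero : malg K M := [fsfun].
Definition malg_add P Q : malg K M :=
  [fsfun m in (malg_supp P `|` malg_supp Q)%fset
    => malg_coef m P + malg_coef m Q].
Definition malg_scale a P : malg K M :=
  [fsfun m in malg_supp P => a * malg_coef m P].
Definition malg_single m : malg K M := [fsfun x in [fset m]%fset => 1].

Lemma malgP P Q : (forall m, malg_coef m P = malg_coef m Q) -> P = Q.
Proof. by move=> eqPQ; apply/fsfunP. Qed.

Lemma malg_supp0 P m : m \notin malg_supp P -> malg_coef m P = 0.
Proof. by rewrite memNfinsupp => /eqP. Qed.

Lemma malg_suppN P m : malg_coef m P = 0 -> m \notin malg_supp P.
Proof. by rewrite memNfinsupp => Pm; apply/eqP. Qed.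

Lemma malg_coef0 m : malg_coef m malg_zero = 0.
Proof. exact: fsfun0E. Qed.

Lemma malg_coefD m P Q :
  malg_coef m (malg_add P Q) = malg_coef m P + malg_coef m Q.
Proof.
rewrite {1}/malg_coef fsfunE inE; case: ifPn => //.
by rewrite negb_or => /andP[/malg_supp0 -> /malg_supp0 ->]; rewrite addr0.
Qed.

Lemma malg_coefZ m a P : malg_coef m (malg_scale a P) = a * malg_coef m P.
Proof.
rewrite {1}/malg_coef fsfunE; case: ifPn => // /malg_supp0 ->.
by rewrite mulr0.
Qed.

Lemma malg_coef1 m m' : malg_coef m' (malg_single m) = (m' == m)%:R.
Proof. by rewrite /malg_coef fsfunE inE; case: eqP. Qed.

Fact malg_addA : associative malg_add.
Proof. by move=> P Q S; apply: malgP => m; rewrite !malg_coefD addrA. Qed.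
Fact malg_addC : commutative malg_add.
Proof. by move=> P Q; apply: malgP => m; rewrite !malg_coefD addrC. Qed.
Fact malg_add0 : left_id malg_zero malg_add.
Proof. by move=> P; apply: malgP => m; rewrite malg_coefD malg_coef0 add0r. Qed.

HB.instance Definition _ := GRing.isNmodule.Build (malg K M)
  malg_addA malg_addC malg_add0.

Fact malg_scaleA a b P :
  malg_scale a (malg_scale b P) = malg_scale (a * b) P.
Proof. by apply: malgP => m; rewrite !malg_coefZ mulrA. Qed.
Fact malg_scale0 P : malg_scale 0 P = 0.
Proof. by apply: malgP => m; rewrite malg_coefZ malg_coef0 mul0r. Qed.
Fact malg_scale1 : left_id 1 malg_scale.
Proof. by move=> P; apply: malgP => m; rewrite malg_coefZ mul1r. Qed.
Fact malg_scaleDr : right_distributive malg_scale +%R.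
Proof.
move=> a P Q; apply: malgP => m.
by rewrite !(malg_coefZ, malg_coefD) mulrDr.
Qed.
Fact malg_scaleDl P : {morph malg_scale^~ P : a b / a + b}.
Proof.
by move=> a b; apply: malgP => m; rewrite !(malg_coefZ, malg_coefD) mulrDl.
Qed.

HB.instance Definition _ := GRing.Nmodule_isLSemiModule.Build K (malg K M)
  malg_scaleA malg_scale0 malg_scale1 malg_scaleDr malg_scaleDl.

End FreeModule.

Arguments malg_single K {M} m.

Section LinearExtension.
Variables (K : nzSemiRingType) (M : choiceType) (V : lSemiModType K).
Implicit Types (f g : M -> V) (P Q : malg K M).

Definition linext f P : V := \sum_(m <- malg_supp P) malg_coef m P *: f m.

Lemma linextE f P (D : {fset M}) : (malg_supp P `<=` D)%fset ->
  linext f P = \sum_(m <- D) malg_coef m P *: f m.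
Proof.
move=> sPD; apply: big_fset_incl => // m _ /malg_supp0 ->.
by rewrite scale0r.
Qed.

Fact linext_is_semilinear f : semilinear (linext f).
Proof.
split=> [a P|P Q].
  rewrite (@linextE f (a *: P) (malg_supp P)); last first.
    apply/fsubsetP => m; apply: contraLR => /malg_supp0 Pm.
    by apply: malg_suppN; rewrite malg_coefZ Pm mulr0.
  by rewrite scaler_sumr; apply: eq_bigr => m _; rewrite malg_coefZ scalerA.
pose D := (malg_supp P `|` malg_supp Q)%fset.
rewrite (@linextE f (P + Q) D); last first.
  apply/fsubsetP => m; apply: contraLR; rewrite inE negb_or.
  case/andP=> /malg_supp0 Pm /malg_supp0 Qm.
  by apply: malg_suppN; rewrite malg_coefD Pm Qm addr0.
rewrite (@linextE f P D) ?fsubsetUl // (@linextE f Q D) ?fsubsetUr //.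
by rewrite -big_split; apply: eq_bigr => m _; rewrite malg_coefD scalerDl.
Qed.

HB.instance Definition _ f :=
  GRing.isSemilinear.Build K (malg K M) V _ (linext f) (linext_is_semilinear f).

Lemma linext_single f m : linext f (malg_single K m) = f m.
Proof.
rewrite (@linextE _ _ [fset m]%fset); last first.
  apply/fsubsetP => x; apply: contraLR; rewrite inE => xm.
  by apply: malg_suppN; rewrite malg_coef1 (negPf xm).
by rewrite big_seq_fset1 malg_coef1 eqxx scale1r.
Qed.

Lemma eq_linext f g : f =1 g -> linext f =1 linext g.
Proof. by move=> eqfg P; apply: eq_bigr => m _; rewrite eqfg. Qed.

Lemma linextD f g P : linext (fun m => f m + g m) P = linext f P + linext g P.
Proof. by rewrite -big_split; apply: eq_bigr => m _; rewrite scalerDr. Qed.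

Lemma linext0 P : linext (fun=> 0) P = 0.
Proof. by rewrite /linext big1 // => m _; rewrite scaler0. Qed.

End LinearExtension.

Lemma linext_comp (K : nzSemiRingType) (M : choiceType) (V W : lSemiModType K)
    (f : M -> V) (h : {linear V -> W}) (P : malg K M) :
  h (linext f P) = linext (h \o f) P.
Proof. by rewrite linear_sum; apply: eq_bigr => m _; rewrite linearZ. Qed.

Lemma linext_id (K : nzSemiRingType) (M : choiceType) (P : malg K M) :
  linext (malg_single K) P = P.
Proof.
apply: malgP => m.
have coefD : {morph malg_coef m : S T / S + T :> malg K M >-> S + T}.
  by move=> S T; apply: malg_coefD.
rewrite /linext (big_morph _ coefD (malg_coef0 K m)).
have coefE x : malg_coef m (malg_coef x P *: malg_single K x) =
    malg_coef x P * (m == x)%:R.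
  by rewrite [LHS]malg_coefZ malg_coef1.
rewrite (eq_bigr _ (fun x _ => coefE x)).
have [mP|mP] := boolP (m \in malg_supp P); last first.
  rewrite (malg_supp0 mP) big_seq big1 // => x xP.
  by case: eqP => [mx|]; rewrite ?mulr0 //; rewrite mx xP in mP.
rewrite (big_rem m) //= eqxx mulr1 big_seq big1 ?addr0 // => x.
rewrite mem_rem_uniq ?fset_uniq // => /andP[xm _].
by rewrite eq_sym (negPf xm) mulr0.
Qed.

Section MonoidAlgebra.
Variables (K : nzSemiRingType) (M : monoidType).
Implicit Types (P Q S : malg K M).

Definition malg_mul P Q : malg K M :=
  linext (fun m => linext (fun n => malg_single K (m * n)%g) Q) P.
Definition malg_one : malg K M := malg_single K 1%g.

Fact malg_mulA : associative malg_mul.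
Proof.
move=> P Q S; rewrite {3}/malg_mul /malg_mul linext_comp.
apply: eq_linext => m /=; rewrite !linext_comp; apply: eq_linext => n /=.
rewrite linext_single linext_comp; apply: eq_linext => p /=.
by rewrite linext_single mulgA.
Qed.

Fact malg_mul1 : left_id malg_one malg_mul.
Proof.
move=> P; rewrite /malg_mul linext_single -[RHS]linext_id.
by apply: eq_linext => m; rewrite mul1g.
Qed.

Fact malg_mulr1 : right_id malg_one malg_mul.
Proof.
move=> P; rewrite -[RHS]linext_id; apply: eq_linext => m.
by rewrite linext_single mulg1.
Qed.

Fact malg_mulDl : left_distributive malg_mul +%R.
Proof. by move=> P Q S; apply: raddfD. Qed.

Fact malg_mulDr : right_distributive malg_mul +%R.
Proof.
move=> P Q S; rewrite /malg_mul -linextD; apply: eq_linext => m.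
exact: raddfD.
Qed.

Fact malg_mul0 : left_zero 0 malg_mul.
Proof. by move=> P; apply: raddf0. Qed.

Fact malg_mulr0 : right_zero 0 malg_mul.
Proof.
move=> P; rewrite -[RHS](linext0 _ P); apply: eq_linext => m.
exact: raddf0.
Qed.

Fact malg_one_neq0 : malg_one != 0.
Proof.
apply/eqP => /(congr1 (malg_coef 1%g))/eqP.
by rewrite malg_coef1 eqxx malg_coef0 oner_eq0.
Qed.

HB.instance Definition _ := GRing.Nmodule_isNzSemiRing.Build (malg K M)
  malg_mulA malg_mul1 malg_mulr1 malg_mulDl malg_mulDr malg_mul0 malg_mulr0
  malg_one_neq0.

Fact malg_scaleAl (a : K) P Q : a *: (P * Q) = (a *: P) * Q.
Proof. by rewrite [RHS]linearZ. Qed.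

HB.instance Definition _ :=
  GRing.LSemiModule_isLSemiAlgebra.Build K (malg K M) malg_scaleAl.

Lemma malg_singleM (m n : M) :
  malg_single K m * malg_single K n = malg_single K (m * n)%g.
Proof. by rewrite [LHS]linext_single linext_single. Qed.

End MonoidAlgebra.

(* K[M] (x) K[N] is K[M * N], m (x) n being the basis element (m, n). *)
Definition tens (K : nzSemiRingType) (M N : choiceType)
    (P : malg K M) (Q : malg K N) : malg K (M * N)%type :=
  linext (fun m => linext (fun n => malg_single K (m, n)) Q) P.

(* f (x) g, defined on the basis: over a noncommutative K it is the left      *)
(* linear map with this effect on basis elements.                             *)
Definition tens_map (K : nzSemiRingType) (M M' N N' : choiceType)
    (f : {linear malg K M -> malg K M'}) (g : {linear malg K N -> malg K N'}) :
    malg K (M * N)%type -> malg K (M' * N')%type :=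
  linext (fun x => tens (f (malg_single K x.1)) (g (malg_single K x.2))).

HB.instance Definition _ (K : nzSemiRingType) (M M' N N' : choiceType)
    (f : {linear malg K M -> malg K M'}) (g : {linear malg K N -> malg K N'}) :=
  GRing.Linear.on (tens_map f g).

Definition word (A : choiceType) := seq A.

HB.instance Definition _ (A : choiceType) := Choice.on (word A).
HB.instance Definition _ (A : choiceType) :=
  isMonoid.Build (word A) (@catA A) (@cat0s A) (@cats0 A).

Definition letter (A : choiceType) (a : A) : word A := [:: a].

Record congruence (M : monoidType) := Congruence {
  congr_rel :> M -> M -> Prop;
  congr_refl : forall u, congr_rel u u;
  congr_sym : forall u v, congr_rel u v -> congr_rel v u;
  congr_trans : forall u v w,
    congr_rel u v -> congr_rel v w -> congr_rel u w;
  congr_mull : forall w u v, congr_rel u v -> congr_rel (w * u)%g (w * v)%g;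
  congr_mulr : forall w u v, congr_rel u v -> congr_rel (u * w)%g (v * w)%g
}.

Inductive gen_rel (M : monoidType) (R : M -> M -> Prop) : M -> M -> Prop :=
| GenBase u v of R u v : gen_rel R u v
| GenRefl u : gen_rel R u u
| GenSym u v of gen_rel R u v : gen_rel R v u
| GenTrans u v w of gen_rel R u v & gen_rel R v w : gen_rel R u w
| GenMull w u v of gen_rel R u v : gen_rel R (w * u)%g (w * v)%g
| GenMulr w u v of gen_rel R u v : gen_rel R (u * w)%g (v * w)%g.

Definition gen_congr (M : monoidType) (R : M -> M -> Prop) : congruence M :=
  Congruence (@GenRefl M R) (@GenSym M R) (@GenTrans M R)
    (@GenMull M R) (@GenMulr M R).

Definition fgen_congr (M : monoidType) (R : {fset M * M}) : congruence M :=
  gen_congr (fun u v => (u, v) \in R).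

Definition generates (M : monoidType) (R : {fset M * M}) (E : congruence M) :=
  forall u v, E u v <-> fgen_congr R u v.

Definition finitely_generated (M : monoidType) (E : congruence M) :=
  exists R : {fset M * M}, generates R E.

Section QuotientMonoid.
Variables (M : monoidType) (E : congruence M).

Definition congr_bool : rel M := fun u v => `[< E u v >].

Fact congr_equiv : equiv_class_of congr_bool.
Proof.
split=> [u|u v|v u w]; first exact/asboolP/congr_refl.
  by apply/asboolP/asboolP => /congr_sym.
by move=> /asboolP uv /asboolP vw; apply/asboolP/(congr_trans uv vw).
Qed.

Canonical congr_equiv_rel := EquivRelPack congr_equiv.

Definition quot_monoid := {eq_quot congr_equiv_rel}.
HB.instance Definition _ := Choice.on quot_monoid.

Definition quot_proj (u : M) : quot_monoid := \pi_({eq_quot congr_equiv_rel}) u.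
Definition quot_repr (x : quot_monoid) : M :=
  repr (x : {eq_quot congr_equiv_rel}).
Definition quot_one : quot_monoid := quot_proj 1%g.
Definition quot_mul (x y : quot_monoid) : quot_monoid :=
  quot_proj (quot_repr x * quot_repr y)%g.

Lemma quot_projP u v : quot_proj u = quot_proj v <-> E u v.
Proof.
split=> [/eqquotP|Euv]; first by move=> /asboolP.
by apply/eqquotP/asboolP.
Qed.

Lemma quot_reprK : cancel quot_repr quot_proj.
Proof. exact: reprK. Qed.

Lemma quot_projM u v : quot_proj (u * v)%g = quot_mul (quot_proj u) (quot_proj v).
Proof.
apply/quot_projP/congr_sym; apply: (@congr_trans _ _ _ (u * quot_repr (quot_proj v))%g).
  by apply: congr_mulr; apply/quot_projP; rewrite quot_reprK.
by apply: congr_mull; apply/quot_projP; rewrite quot_reprK.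
Qed.

Fact quot_mulA : associative quot_mul.
Proof.
move=> x y z; rewrite -[x]quot_reprK -[y]quot_reprK -[z]quot_reprK.
by rewrite -!quot_projM mulgA.
Qed.
Fact quot_mul1 : left_id quot_one quot_mul.
Proof. by move=> x; rewrite -[x]quot_reprK -quot_projM mul1g. Qed.
Fact quot_mulr1 : right_id quot_one quot_mul.
Proof. by move=> x; rewrite -[x]quot_reprK -quot_projM mulg1. Qed.

HB.instance Definition _ :=
  isMonoid.Build quot_monoid quot_mulA quot_mul1 quot_mulr1.

Definition nat_map (K : nzSemiRingType) : malg K M -> malg K quot_monoid :=
  linext (fun u => malg_single K (quot_proj u)).

HB.instance Definition _ (K : nzSemiRingType) :=
  GRing.Linear.on (@nat_map K).

End QuotientMonoid.

Arguments nat_map {M} E {K}.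

(* The multiplicative map c on the free monoid with c(a) = a (x) 1 + 1 (x) a, *)
(* extended linearly.                                                         *)
Definition shuffle_coproduct (K : nzSemiRingType) (A : choiceType) :
    malg K (word A) -> malg K (word A * word A)%type :=
  linext (fun w => \prod_(a <- (w : seq A))
    (tens (malg_single K (letter a)) 1 + tens 1 (malg_single K (letter a)))).

HB.instance Definition _ (K : nzSemiRingType) (A : choiceType) :=
  GRing.Linear.on (@shuffle_coproduct K A).

Section ShuffleCoproduct.
Variables (K : nzSemiRingType) (A : choiceType).

Lemma shuffle_coproduct1 :
  shuffle_coproduct (1 : malg K (word A)) = tens 1 1.
Proof.
rewrite [LHS]linext_single big_nil.
by rewrite [RHS]linext_single linext_single.
Qed.

Lemma shuffle_coproduct_letter (a : A) :
  shuffle_coproduct (malg_single K (letter a)) =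
  tens (malg_single K (letter a)) 1 + tens 1 (malg_single K (letter a)).
Proof. by rewrite [LHS]linext_single big_seq1. Qed.

Lemma shuffle_coproductM (u v : word A) :
  shuffle_coproduct (malg_single K u * malg_single K v) =
  shuffle_coproduct (malg_single K u) * shuffle_coproduct (malg_single K v).
Proof.
by rewrite malg_singleM /shuffle_coproduct !linext_single -big_cat.
Qed.

Lemma tens_singleM (m m' n n' : word A) :
  tens (malg_single K m) (malg_single K m') *
    tens (malg_single K n) (malg_single K n') =
  tens (malg_single K (m * n)%g) (malg_single K (m' * n')%g).
Proof. by rewrite /tens !linext_single malg_singleM. Qed.

End ShuffleCoproduct.

Section ShuffleCompatible.
Variables (K : nzSemiRingType) (A : choiceType) (E : congruence (word A)).

Definition is_quot_coproduct (c : {linear malg K (quot_monoid E) ->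
    malg K (quot_monoid E * quot_monoid E)%type}) : Prop :=
  forall P : malg K (word A),
    c (nat_map E P) = tens_map (nat_map E) (nat_map E) (shuffle_coproduct P).

Definition shuffle_compatible : Prop := exists c, is_quot_coproduct c.

(* There is at most one quotient coproduct, since nat_map is surjective. *)
Definition primitive (P : malg K (quot_monoid E)) : Prop :=
  exists2 c, is_quot_coproduct c & c P = tens P 1 + tens 1 P.

End ShuffleCompatible.

Definition is_ring (K : nzSemiRingType) : Prop :=
  forall x : K, exists y : K, x + y = 0.

(* d = x - y.  A semiring structure carries no subtraction, even when its     *)
(* addition is a group; over a ring, d exists and is unique.                  *)
Definition is_difference (V : nmodType) (x y d : V) : Prop := d + y = x.

Definition commutation_rel (B : choiceType) (theta : rel B)
    (u v : word B) : Prop :=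
  exists2 ab : B * B, theta ab.1 ab.2 &
    u = (letter ab.1 * letter ab.2)%g /\ v = (letter ab.2 * letter ab.1)%g.

Definition pc_monoid (B : choiceType) (theta : rel B) : monoidType :=
  quot_monoid (gen_congr (commutation_rel theta)).

Definition monoid_isomorphic (M N : monoidType) : Prop :=
  exists f : M -> N, [/\ f 1%g = 1%g, {morph f : x y / (x * y)%g} & bijective f].

Definition partially_commutative (M : monoidType) : Prop :=
  exists (B : choiceType) (theta : rel B),
    [/\ symmetric theta, irreflexive theta &
        monoid_isomorphic M (pc_monoid theta)].

Definition is_partition (T : choiceType) (n : nat) (R : {fset T})
    (R_ : 'I_n -> {fset T}) : Prop :=
  [/\ R = (\bigcup_(i in 'I_n) R_ i)%fset,
      forall i, R_ i != fset0 &
      forall i j, i != j -> [disjoint R_ i & R_ j]%fset].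

(* Main.v *)
Require Import Defs.
From HB Require Import structures.
From mathcomp Require Import all_boot all_algebra finmap.
From mathcomp.classical Require Import boolp.
Set Implicit Arguments.
Unset Strict Implicit.
Unset Printing Implicit Defensive.
Import GRing.Theory.
Local Open Scope ring_scope.

(* The coproduct of the class of a word [u] is the sum of the tensors         *)
(* [v (x) w] over the splittings of [u] into two complementary subwords [v]   *)
(* and [w]; its coefficients are the images in [K] of natural numbers.        *)
(*                                                                            *)
(* Prime characteristic: let [E_i] be the congruence generated by the pairs   *)
(* of [E] with both lengths less than [i], over the finitely many letters     *)
(* occurring in a finite generating set.  For words of length less than [i]   *)
(* over these letters, [E] and [E_i] agree.  If [u] and [v] are [E]-          *)
(* equivalent of length at most [i], all tensors in the coproduct of [u - v]  *)
(* except the extreme ones involve only words of length less than [i], so     *)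
(* they cancel over [E_i] because they cancel over [E].                       *)
(*                                                                            *)
(* Otherwise no prime vanishes in [K], so that for every [i > 1] some         *)
(* binomial ['C(i, k)] with [0 < k < i] is nonzero in [K].  Take as alphabet  *)
(* the nontrivial classes of letters.  By induction on the length, two        *)
(* equivalent words have the same projection on every pair of letters that do *)
(* not commute, hence are equal up to commutations.  When the projection is a *)
(* proper subword its splitting has coefficient 1, and the induction          *)
(* hypothesis applies to it; there remain words in two letters [a] and [b],   *)
(* with, say, [i > 1] occurrences of [a].  If two such words differ, then     *)
(* comparing the coefficients of [a ^ r (x) w], where [w] keeps a single      *)
(* block of [a]'s, forces each word to have all its [a]'s in one block, and a *)
(* nonzero ['C(i, k)] separates the two.                                      *)

(** By [shuffle_compatibleP], compatibility says that equivalent words have, for each pair of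
    classes, the same number of splittings as seen in [K].

    When no prime vanishes in [K] (for a semiring that is not a ring, by [pchar_is_ring]),
    [image_neq1] shows that no nonempty product of nontrivial letter classes is 1. Proper splittings
    then match proper splittings, and [image_step] inducts on length: [image_filter] cuts a word
    along a set of letters, [image_constant] treats powers of a letter and [image_two_letters]
    treats two noncommuting letters. The last two rest on [binomial_neq0]. Finally
    [same_projections_commutation] turns equal projections into commutations.

    Over a ring, the tensors with a trivial factor can be cancelled; what remains is governed by
    shorter words, whence [quot_coprod_agree] and [primitive_agree] for the layers. *)

Section BasisSums.
Variables (K : nzSemiRingType) (M : choiceType).

Lemma malg_coef_sum (I : Type) (s : seq I) (P : I -> malg K M) m :
  malg_coef m (\sum_(x <- s) P x) = \sum_(x <- s) malg_coef m (P x).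
Proof.
by apply: (big_morph (malg_coef m)) => [P1 P2|]; [apply: malg_coefD | apply: malg_coef0].
Qed.

Lemma malg_coef_sum_single (I : Type) (s : seq I) (f : I -> M) m :
  malg_coef m (\sum_(x <- s) malg_single K (f x))
  = (count (fun x => f x == m) s)%:R.
Proof.
rewrite malg_coef_sum -sum1_count natr_sum [RHS]big_mkcond /=.
by apply: eq_bigr => x _; rewrite malg_coef1 eq_sym; case: eqP.
Qed.

Lemma malg_addIr : is_ring K -> right_injective (+%R : malg K M -> _).
Proof.
move=> Kring P Q S /(congr1 (malg_coef _)) eqPQ; apply: malgP => m.
have := eqPQ m; rewrite !malg_coefD; have [y Py] := Kring (malg_coef m P).
by move=> /(congr1 (+%R y)); rewrite !addrA [y + _]addrC Py !add0r.
Qed.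

(** Since [f x] determines [h x] on the indices involved, a linear map sending each [f x] to [h x]
    carries one equation to the other. *)
Lemma sum_single_factor (T : eqType) (N : choiceType) (f : T -> M) (h : T -> N)
    (s t : seq T) :
  {in s ++ t &, forall x y, f x = f y -> h x = h y} ->
  \sum_(x <- s) malg_single K (f x) = \sum_(x <- t) malg_single K (f x) ->
  \sum_(x <- s) malg_single K (h x) = \sum_(x <- t) malg_single K (h x).
Proof.
move=> fh eq_st.
(* [F] uses the first index at which [f] takes the value [m], and is 0 at values that are not
   taken. *)
pose F m := nth 0 [seq malg_single K (h x) | x <- s ++ t]
  (find (fun x => f x == m) (s ++ t)).
have FE x : x \in s ++ t -> linext F (malg_single K (f x)) = malg_single K (h x).
  move=> xs; rewrite linext_single /F.
  have has_x : has (fun y => f y == f x) (s ++ t) by apply/hasP; exists x.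
  rewrite (nth_map x) -?has_find //; congr malg_single.
  apply: fh => //; first by rewrite mem_nth // -has_find.
  exact/eqP/(nth_find x has_x).
transitivity (linext F (\sum_(x <- s) malg_single K (f x))).
  rewrite (raddf_sum (linext F)); apply: eq_big_seq => x xs.
  by rewrite /= FE // mem_cat xs.
rewrite eq_st (raddf_sum (linext F)); apply: eq_big_seq => x xt.
by rewrite /= FE // mem_cat xt orbT.
Qed.

End BasisSums.

(** * Splittings of a word into complementary subwords *)

Section Splittings.
Variable T : eqType.
Implicit Types (u v w : seq T) (x : seq T * seq T).

Fixpoint splits u : seq (seq T * seq T) :=
  if u is a :: u' then
    [seq (a :: x.1, x.2) | x <- splits u'] ++ [seq (x.1, a :: x.2) | x <- splits u']
  else [:: ([::], [::])].

Lemma splits_perm u x : x \in splits u -> perm_eq (x.1 ++ x.2) u.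
Proof.
elim: u x => [|a u IHu] x /=; first by rewrite inE => /eqP->.
rewrite mem_cat => /orP[] /mapP[y /IHu yu ->] /=; first by rewrite perm_cons.
by rewrite (perm_catCA y.1 [:: a] y.2) perm_cons.
Qed.

Lemma splits_size u x : x \in splits u -> (size x.1 + size x.2)%N = size u.
Proof. by move=> /splits_perm/perm_size; rewrite size_cat. Qed.

Lemma splits_all (P : pred T) u x : x \in splits u -> all P u -> all P x.1 && all P x.2.
Proof. by move=> /splits_perm xu Pu; rewrite -all_cat (perm_all _ xu). Qed.

Lemma splits_l u : (u, [::]) \in splits u.
Proof.
elim: u => [|a u IHu] //=; rewrite mem_cat; apply/orP; left.
by apply/mapP; exists (u, [::]).
Qed.

Lemma splits_r u : ([::], u) \in splits u.
Proof.
elim: u => [|a u IHu] //=; rewrite mem_cat; apply/orP; right.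
by apply/mapP; exists ([::], u).
Qed.

Definition proper_split x := (x.1 != [::]) && (x.2 != [::]).

(** One side is empty only if every letter goes to the other, so each extreme splitting occurs
    exactly once. *)
Lemma splits_proper u : u != [::] ->
  perm_eq (splits u) ((u, [::]) :: ([::], u) :: filter proper_split (splits u)).
Proof.
have nil_l w : count (fun x => x.1 == [::]) (splits w) = 1%N.
  elim: w => [|a w IHw] //=; rewrite count_cat !count_map.
  by rewrite (@eq_count _ _ pred0) // count_pred0 add0n.
have nil_r w : count (fun x => x.2 == [::]) (splits w) = 1%N.
  elim: w => [|a w IHw] //=; rewrite count_cat !count_map addnC.
  by rewrite (@eq_count _ _ pred0) // count_pred0 add0n.
have filter1 (P : pred (seq T * seq T)) y s :
    y \in s -> P y -> count P s = 1%N -> filter P s = [:: y].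
  move=> ys Py; rewrite -size_filter.
  have: y \in filter P s by rewrite mem_filter Py.
  by case: (filter P s) => [|z [|//]] //; rewrite inE => /eqP->.
move=> uN0; set S := splits u.
have S_r : filter (fun x => x.1 == [::]) S = [:: ([::], u)].
  by apply: filter1 => //; [apply: splits_r | apply: nil_l].
have S_l : filter (fun x => x.2 == [::]) (filter (fun x => x.1 != [::]) S)
    = [:: (u, [::])].
  apply: filter1 => //; first by rewrite mem_filter uN0 splits_l.
  rewrite -(nil_r u) count_filter; apply: eq_in_count => -[x y] xyu /=.
  case: eqP => //= y0; move: (splits_size xyu); rewrite y0 /= addn0.
  by case: (x) => //=; case: (u) uN0.
have S_p : filter proper_split S
    = filter (fun x => x.2 != [::]) (filter (fun x => x.1 != [::]) S).
  by rewrite -filter_predI; apply: eq_filter => x; rewrite /= andbC.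
have permC := fun P s => permEl (perm_filterC P s).
rewrite perm_sym S_p -[_ :: _ :: _]/([:: _] ++ [:: _] ++ _) perm_catCA.
apply: (perm_trans _ (permC _ (fun x => x.1 == [::]) S)); rewrite S_r perm_cat2l.
by apply: (perm_trans _ (permC _ (fun x => x.2 == [::]) _)); rewrite S_l.
Qed.

(** [P] dictates the side of every letter. This is the source of the coefficients equal to 1, which
    are nonzero in every [K]. *)
Lemma splits_filter (P : pred T) u :
  count (fun x => all P x.1 && all (predC P) x.2) (splits u) = 1%N
  /\ (filter P u, filter (predC P) u) \in splits u.
Proof.
elim: u => [|a u [IHu IHm]] //=; rewrite count_cat !count_map mem_cat /=.
case: (boolP (P a)) => Pa /=; split.
- rewrite [X in (_ + X)%N](@eq_count _ _ pred0) => [|x /=]; last first.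
    by rewrite Pa andbF.
  rewrite count_pred0 addn0 -[RHS]IHu; apply: eq_count => x /=; by rewrite Pa.
- by apply/orP; left; apply/mapP; exists (filter P u, filter (predC P) u).
- rewrite (@eq_count _ _ pred0) => [|x /=]; last by rewrite (negPf Pa).
  rewrite count_pred0 add0n -[RHS]IHu; apply: eq_count => x /=; by rewrite Pa.
- by apply/orP; right; apply/mapP; exists (filter P u, filter (predC P) u).
Qed.

Lemma splits_filterP (P : pred T) u x : x \in splits u ->
  all P x.1 -> all (predC P) x.2 -> x = (filter P u, filter (predC P) u).
Proof.
move=> xu P1 P2; have [c1 m1] := splits_filter P u.
have memf (z : seq T * seq T) : z \in splits u -> all P z.1 && all (predC P) z.2 ->
    z \in [seq z <- splits u | all P z.1 && all (predC P) z.2].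
  by rewrite mem_filter => -> ->.
have := memf _ xu; have := memf _ m1; rewrite P1 P2 /= !filter_all /=.
move: c1; rewrite -size_filter.
case: (filter _ (splits u)) => [|z [|//]] // _ h1 h2.
have := h2 isT; have := h1 isT; by rewrite !inE => /eqP-> /eqP->.
Qed.

End Splittings.

Lemma splits_map (T U : eqType) (f : T -> U) (u : seq T) :
  splits (map f u) = [seq (map f x.1, map f x.2) | x <- splits u].
Proof.
elim: u => //= a u IHu; rewrite IHu map_cat -!map_comp.
by congr (_ ++ _); apply: eq_map => x.
Qed.

(** * The coproduct modulo a congruence *)

Section QuotientCoproduct.
Variables (K : nzSemiRingType) (A : choiceType).

(** Expanding the product amounts to choosing a side for each letter. A general morphism [f] covers
    both the free monoid and its quotient. *)
Lemma sum_splits_prod (M : monoidType) (f : word A -> M) (u : word A) :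
    f 1%g = 1%g -> {morph f : u v / (u * v)%g} ->
  \sum_(x <- splits u) malg_single K (f x.1, f x.2) =
  \prod_(a <- (u : seq A))
    (malg_single K (f (letter a), 1%g) + malg_single K (1%g, f (letter a))).
Proof.
move=> f1 fM; elim: u => [|a u IHu]; first by rewrite big_nil big_seq1 /= f1.
rewrite big_cons -IHu /= big_cat !big_map mulrDl !mulr_sumr.
have pairM (x y x' y' : M) :
    malg_single K (x, y) * malg_single K (x', y') =
    malg_single K ((x * x')%g, (y * y')%g) by exact: malg_singleM.
by congr (_ + _); apply: eq_bigr => x _; rewrite pairM mul1g -fM.
Qed.

Lemma shuffle_coproduct_splits (u : word A) :
  shuffle_coproduct (malg_single K u) = \sum_(x <- splits u) malg_single K x.
Proof.
rewrite [LHS]linext_single.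
rewrite -[RHS](eq_bigr _ (fun x _ => congr1 (malg_single K) (esym (surjective_pairing x)))).
rewrite (@sum_splits_prod _ id) //; apply: eq_bigr => a _.
by rewrite /tens !linext_single.
Qed.

Variable E : congruence (word A).

Definition quot_coprod (u : word A) : malg K (quot_monoid E * quot_monoid E)%type :=
  \sum_(x <- splits u) malg_single K (quot_proj E x.1, quot_proj E x.2).

Lemma quot_coprodE (u : word A) :
  tens_map (nat_map E) (nat_map E) (shuffle_coproduct (malg_single K u)) =
  quot_coprod u.
Proof.
rewrite shuffle_coproduct_splits (raddf_sum (tens_map (nat_map E) (nat_map E))).
apply: eq_bigr => x _ /=; rewrite [LHS]linext_single /= /nat_map !linext_single.
by rewrite /tens !linext_single.
Qed.

Lemma quot_coprodM (u v : word A) :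
  quot_coprod (u * v)%g = quot_coprod u * quot_coprod v.
Proof.
rewrite /quot_coprod !(@sum_splits_prod _ (quot_proj E)) ?big_cat //;
  exact: quot_projM.
Qed.

Lemma shuffle_compatibleP :
  shuffle_compatible K E <-> forall u v, E u v -> quot_coprod u = quot_coprod v.
Proof.
split=> [[c cE] u v Euv|coprodE].
  rewrite -!quot_coprodE -!cE /nat_map !linext_single.
  by congr (c (malg_single K _)); apply/quot_projP.
exists (linext (fun x => quot_coprod (quot_repr x))) => P.
transitivity (linext quot_coprod P).
  rewrite /nat_map linext_comp; apply: eq_linext => u /=.
  by rewrite linext_single; apply/coprodE/quot_projP; rewrite quot_reprK.
rewrite [RHS]linext_comp; apply: eq_linext => u.
by rewrite -quot_coprodE [X in tens_map _ _ X]linext_single.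
Qed.

Lemma quot_coprod_count u m :
  malg_coef m (quot_coprod u) =
  (count (fun x => (quot_proj E x.1, quot_proj E x.2) == m) (splits u))%:R.
Proof. exact: malg_coef_sum_single. Qed.

End QuotientCoproduct.

(** [quot_coprod] is multiplicative, so equality of its values passes through every closure rule of
    a generated congruence. *)
Lemma shuffle_compatible_gen (K : nzSemiRingType) (A : choiceType)
    (R : word A -> word A -> Prop) :
  (forall u v, R u v ->
     quot_coprod K (gen_congr R) u = quot_coprod K (gen_congr R) v) ->
  shuffle_compatible K (gen_congr R).
Proof.
move=> coprodR; apply/shuffle_compatibleP => u v Euv.
have {Euv} : gen_rel R u v by [].
move: (gen_congr R) coprodR => E coprodR.
by elim=> // {u v} [u v w _ -> _ ->|w u v _ Euv|w u v _ Euv] //;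
  rewrite !quot_coprodM Euv.
Qed.

(** * Common divisors of the binomial coefficients of a row *)

Section Binomials.
Local Open Scope nat_scope.

(** Take valuations in [k * 'C(i, k) = i * 'C(i.-1, k.-1)], whose last factor is prime to [p]. *)
Lemma logn_binomials p i k : prime p ->
  (forall k, 0 < k < i -> p %| 'C(i, k)) -> 0 < k < i ->
  logn p i = logn p k + logn p 'C(i, k).
Proof.
move=> p_pr pC ki; have i_gt0 : 0 < i by case: i ki {pC}; rewrite ?andbF.
(* By Pascal's rule ['C(i.-1, k)] is [(-1) ^ k] modulo [p]. *)
have p'C j : j < i -> ~~ (p %| 'C(i.-1, j)).
  elim: j => [|j IHj] ji; first by rewrite bin0 dvdn1; case: eqP p_pr => // ->.
  have := pC j.+1; have := binS i.-1 j; rewrite prednK // ji => -> /(_ isT).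
  by move=> pD; apply: contra (IHj (ltnW ji)) => pj; rewrite -(dvdn_addr _ pj).
case: k ki => // k ki; have e := mul_bin_diag i k.
have C_gt0 : 0 < 'C(i, k.+1) by rewrite bin_gt0 ltnW.
rewrite -lognM // -e lognM //; last by rewrite bin_gt0 -ltnS prednK // ltnW.
by rewrite [X in _ = _ + X]lognE // (negPf (p'C k (ltnW ki))) !andbF addn0.
Qed.

(** Otherwise [k = p ^ logn p i] is less than [i], and [logn_binomials] makes ['C(i, k)] prime to
    [p]. *)
Lemma binomials_prime_power p i : prime p -> 1 < i ->
  (forall k, 0 < k < i -> p %| 'C(i, k)) -> i = p ^ logn p i.
Proof.
move=> p_pr i_gt1 pC; have i_gt0 : 0 < i by apply: ltnW.
apply/eqP; rewrite eqn_leq andbC dvdn_leq ?pfactor_dvdnn //=.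
rewrite leqNgt; apply/negP => ki.
have k_i : 0 < p ^ logn p i < i by rewrite expn_gt0 prime_gt0.
have := logn_binomials p_pr pC k_i; rewrite pfactorK // => /eqP.
rewrite -{1}[logn p i]addn0 eqn_add2l eq_sym lognE p_pr bin_gt0 ltnW //=.
by rewrite pC.
Qed.

(** If [d] is not its least prime factor [p], some [p * q] with [q] prime divides [d]. As
    [i = 'C(i, 1)] is a power of [p], [q = p]. But for [k = p ^ (logn p i).-1] the valuation of
    ['C(i, k)] at [p] is exactly 1. *)
Lemma prime_dvd_binomials i d : 1 < i -> 1 < d ->
  (forall k, 0 < k < i -> d %| 'C(i, k)) -> prime d.
Proof.
move=> i_gt1 d_gt1 dC; set p := pdiv d; have p_pr : prime p by apply: pdiv_prime.
have [d_eq|[q q_pr pqd]] : d = p \/ exists2 q, prime q & p * q %| d.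
  have /dvdnP[e de] := pdiv_dvd d; case: (ltngtP e 1) => [|e_gt1|e1].
  - by rewrite ltnS leqn0 => /eqP e0; rewrite de e0 in d_gt1.
  - right; exists (pdiv e); first exact: pdiv_prime.
    by rewrite [X in _ %| X]de mulnC dvdn_mul // pdiv_dvd.
  - by left; rewrite de e1 mul1n.
  by rewrite d_eq.
have pC k : 0 < k < i -> p %| 'C(i, k).
  by move=> /dC; apply: dvdn_trans; apply: pdiv_dvd.
have i_pow := binomials_prime_power p_pr i_gt1 pC.
have log_gt0 : 0 < logn p i by case: (logn p i) i_pow i_gt1 => // ->.
have pq : p = q.
  have := dC 1; rewrite i_gt1 bin1 => /(_ isT).
  move=> /(dvdn_trans (dvdn_trans (dvdn_mull p (dvdnn q)) pqd)).
  by rewrite i_pow Euclid_dvdX // log_gt0 andbT dvdn_prime2 // => /eqP.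
have k_i : 0 < p ^ (logn p i).-1 < i.
  by rewrite expn_gt0 prime_gt0 //= [X in _ < X]i_pow ltn_exp2l ?prime_gt1 // prednK.
have := dvdn_trans pqd (dC _ k_i); rewrite -pq mulnn pfactor_dvdn //; last first.
  by rewrite bin_gt0 ltnW //; case/andP: k_i.
have := logn_binomials p_pr pC k_i; rewrite pfactorK // -{1}(prednK log_gt0).
by rewrite -add1n addnC => /addnI <-.
Qed.

End Binomials.

(** If all of them vanished, the least positive integer vanishing in [K] would divide them all,
    hence be a prime in [[pchar K]]. *)
Lemma binomial_neq0 (K : nzSemiRingType) i :
    (forall p : nat, p \notin [pchar K]) -> (1 < i)%N ->
  exists2 k, (0 < k < i)%N & 'C(i, k)%:R != 0 :> K.
Proof.
move=> K_nchar i_gt1; apply: contrapT => noC.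
have C0 k : (0 < k < i)%N -> 'C(i, k)%:R = 0 :> K.
  by move=> ki; apply: contrapT => Ck; apply: noC; exists k => //; apply/eqP.
have ex_d : exists d, (0 < d)%N && (d%:R == 0 :> K).
  by exists i; rewrite ltnW //= -[i]bin1 C0 // i_gt1.
case: (ex_minnP ex_d) => d /andP[d_gt0 /eqP d0] d_min.
(* Even without subtraction, [n] and its remainder modulo [d] have the same image in [K]. *)
have dvd_d n : n%:R = 0 :> K -> (d %| n)%N.
  rewrite {1}(divn_eq n d) natrD natrM d0 mulr0 add0r => r0.
  rewrite /dvdn; apply: contraTT isT => r_neq0.
  have := d_min (n %% d)%N; rewrite lt0n r_neq0 r0 eqxx => /(_ isT).
  by rewrite leqNgt ltn_pmod.
have d_gt1 : (1 < d)%N.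
  by case: d d_gt0 d0 {d_min dvd_d} => [|[|d]] // _ /eqP; rewrite oner_eq0.
have /negP := K_nchar d; apply; rewrite !inE d0 eqxx andbT.
by apply: (@prime_dvd_binomials i) => // k /C0/dvd_d.
Qed.

(** * Splitting off a power of one letter *)

Section Blocks.
Local Open Scope nat_scope.
Variables (T : eqType) (a : T).
Implicit Types (u v w p s : seq T).

(** This is the coefficient of [u] in the shuffle product of [w] and [w']. *)
Definition shuffle_coef u w w' := count_mem (w, w') (splits u).

Lemma shuffle_coef_cons c u w w' :
  shuffle_coef (c :: u) w w' =
  (if w is d :: w1 then (d == c) * shuffle_coef u w1 w' else 0) +
  (if w' is d :: w1' then (d == c) * shuffle_coef u w w1' else 0).
Proof.
rewrite /shuffle_coef /= count_cat !count_map; congr (_ + _).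
  case: w => [|d w]; first by rewrite -(count_pred0 (splits u)); apply: eq_count.
  case: eqP => [->|dc]; rewrite ?mul1n ?mul0n.
    by apply: eq_count => x; rewrite /= !xpair_eqE eqseq_cons eqxx.
  rewrite -(count_pred0 (splits u)); apply: eq_count => x.
  by rewrite /= xpair_eqE eqseq_cons eq_sym; case: eqP.
case: w' => [|d w'].
  rewrite -(count_pred0 (splits u)); apply: eq_count => x.
  by rewrite /= xpair_eqE andbF.
case: eqP => [->|dc]; rewrite ?mul1n ?mul0n.
  by apply: eq_count => x; rewrite /= !xpair_eqE eqseq_cons eqxx.
rewrite -(count_pred0 (splits u)); apply: eq_count => x.
by rewrite /= xpair_eqE eqseq_cons; case: (c =P d) => [cd|_]; rewrite ?andbF //; case: dc.
Qed.

Lemma shuffle_coef_nil u : shuffle_coef u [::] u = 1.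
Proof.
by elim: u => [|c u IHu]; rewrite ?shuffle_coef_cons // eqxx IHu.
Qed.

Lemma shuffle_coef_gt0 u w w' : (0 < shuffle_coef u w w') = ((w, w') \in splits u).
Proof. by rewrite -has_count has_pred1. Qed.

Definition free_of : pred (seq T) := all (predC1 a).

(** Sending the first [a] to the left or to the right gives Pascal's rule. *)
Lemma shuffle_coef_pow r q s : free_of s ->
  shuffle_coef (nseq (r + q) a ++ s) (nseq r a) (nseq q a ++ s) = 'C(r + q, r).
Proof.
move=> s_a; elim: r q => [|r IHr] q; first by rewrite bin0 shuffle_coef_nil.
elim: q => [|q IHq].
  have := IHr 0; rewrite !addn0 !binn /= shuffle_coef_cons eqxx mul1n => ->.
  case: s s_a {IHr} => //= c s /andP[/negPf ca _].
  by rewrite ca addn0.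
rewrite addnS /= shuffle_coef_cons eqxx !mul1n binS [LHS]addnC IHq.
by congr (_ + _); have := IHr q.+1; rewrite addnS.
Qed.

Lemma shuffle_coef_cat p s s' r : free_of p ->
  shuffle_coef (p ++ s) (nseq r a) (p ++ s') = shuffle_coef s (nseq r a) s'.
Proof.
elim: p => //= c p IHp /andP[/negPf ca p_a].
rewrite shuffle_coef_cons eqxx mul1n IHp //.
by case: (r) => [|n] //=; rewrite eq_sym ca.
Qed.

(* [block u k] is the number of occurrences of [a] in [u] that are preceded   *)
(* by exactly [k] letters other than [a], and [keep_block k u] deletes all    *)
(* the other occurrences of [a].                                              *)
Fixpoint block u k :=
  if u is c :: u' then
    if c == a then (k == 0) + block u' k
    else if k is k'.+1 then block u' k' else 0
  else 0.

Fixpoint keep_block k u :=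
  if u is c :: u' then
    if c == a then if k == 0 then c :: keep_block k u' else keep_block k u'
    else c :: (if k is k'.+1 then keep_block k' u' else filter (predC1 a) u')
  else [::].

Lemma block_big u k : count (predC1 a) u < k -> block u k = 0.
Proof.
elim: u k => //= c u IHu k; case: eqP => _ /=; first by case: k => // k; apply: IHu.
by case: k => // k; apply: IHu.
Qed.

Lemma sum_block u n : count (predC1 a) u < n ->
  count_mem a u = \sum_(k < n) block u k.
Proof.
elim: u n => [|c u IHu] n /=; first by rewrite big1.
case: n => // n; case: eqP => _ /= un.
  rewrite (IHu n.+1) // big_split /=; congr (_ + _).
  by rewrite big_ord_recl /= big1.
by rewrite big_ord_recl /= !add0n; apply: IHu.
Qed.

Lemma block_leq u k : block u k <= count_mem a u.
Proof.
have [ku|/block_big-> //] := leqP k (count (predC1 a) u).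
by rewrite (sum_block (leqnn _)) (bigD1 (Ordinal (ku : k < _.+1))) //= leq_addr.
Qed.

Lemma block_full u k l : block u k = count_mem a u -> l != k -> block u l = 0.
Proof.
move=> uk lk; have [lu|/block_big-> //] := leqP l (count (predC1 a) u).
have [ku|k_big] := leqP k (count (predC1 a) u); last first.
  by apply/eqP; rewrite -leqn0 -(block_big k_big) uk block_leq.
apply/eqP; rewrite -leqn0 -(leq_add2l (block u k)) addn0 {2}uk.
rewrite (sum_block (leqnn _)) (bigD1 (Ordinal (ku : k < _.+1))) //= leq_add2l.
by rewrite (bigD1 (Ordinal (lu : l < _.+1))) //= leq_addr.
Qed.

Lemma block_inj u v : filter (predC1 a) u = filter (predC1 a) v ->
  block u =1 block v -> u = v.
Proof.
elim: u v => [|c u IHu] v.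
  case: v => //= d v; have [->|da] := eqVneq d a; last by [].
  by move=> _ /(_ 0).
have [->|ca] := eqVneq c a.
  case: v => [|d v] /=; rewrite eqxx /=; first by move=> _ /(_ 0).
  have [-> uv|da _ /(_ 0)] := eqVneq d a; last by rewrite /= ?eqxx ?(negPf da).
  move=> b_uv; rewrite (IHu v) // => k; have := b_uv k.
  by rewrite /= ?eqxx => /addnI.
case: v => [|d v] /=; rewrite ?(negPf ca) //=.
have [->|da] := eqVneq d a; first by move=> _ /(_ 0).
by move=> [-> uv] b_uv; rewrite (IHu v) // => k; apply: (b_uv k.+1).
Qed.

Lemma block_insert p r s l : free_of p -> free_of s ->
  block (p ++ nseq r a ++ s) l = (l == size p) * r.
Proof.
move=> p_a s_a; have s0 k : block s k = 0.
  have a_s : a \notin s by apply/negP => /(allP s_a); rewrite /= eqxx.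
  by have := block_leq s k; rewrite (count_memPn a_s) leqn0 => /eqP.
elim: p l p_a => [|c p IHp] l /=.
  by elim: r => [|r IHr] _ /=; rewrite ?s0 ?muln0 // eqxx IHr // mulnS.
by case/andP=> /negPf-> /IHp{}IHp; case: l.
Qed.

(** Only occurrences of [a] are removed, so the remaining ones stay in their blocks. *)
Lemma split_block r w u k : (nseq r a, w) \in splits u -> block w k <= block u k.
Proof.
rewrite -shuffle_coef_gt0.
elim: u r w k => [|c u IHu] r w k; first by case: r => //; case: w.
rewrite shuffle_coef_cons addn_gt0 => /orP[].
  case: r => //= r; rewrite muln_gt0 lt0b => /andP[/eqP<-]; rewrite eqxx => /IHu.
  by move=> /(_ k) /leq_trans; apply; apply: leq_addl.
case: w => //= d w; rewrite muln_gt0 lt0b => /andP[/eqP-> /IHu wu].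
by case: eqP => _; [rewrite leq_add2l | case: k].
Qed.

Lemma block_keep u k : block (keep_block k u) k = block u k.
Proof.
elim: u k => //= c u IHu k; have [->|ca] := eqVneq c a.
  by case: k => /= [|k]; rewrite ?eqxx IHu.
by rewrite /= (negPf ca); case: k.
Qed.

Lemma shuffle_coef_filter u :
  shuffle_coef u (nseq (count_mem a u) a) (filter (predC1 a) u) = 1.
Proof.
elim: u => //= c u IHu; rewrite shuffle_coef_cons.
have [->|ca] /= := eqVneq c a; last first.
  by rewrite eqxx IHu; case: (count_mem a u) => //= n; rewrite eq_sym (negPf ca).
rewrite eqxx mul1n IHu; have := filter_all (predC1 a) u.
by case: (filter _ u) => //= d w /andP[/negPf->].
Qed.

(** The right word has as many [a]'s in block [k] as [u], so all of that block must go right, and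
    the other [a]'s left. *)
Lemma shuffle_coef_keep u k :
  shuffle_coef u (nseq (count_mem a u - block u k) a) (keep_block k u) = 1.
Proof.
elim: u k => //= c u IHu k; rewrite shuffle_coef_cons.
have [->|ca] /= := eqVneq c a; last first.
  rewrite eqxx mul1n add0n; set n := (X in nseq X a).
  rewrite [X in X + _](_ : _ = 0); last first.
    by case: n => //= n; rewrite eq_sym (negPf ca).
  by rewrite {}/n; case: k => [|k] /=; rewrite ?subn0 ?shuffle_coef_filter ?IHu.
case: k => [|k] /=.
  rewrite subnDl eqxx mul1n IHu; case En: (_ - _) => [|n] //=; rewrite eqxx mul1n.
  apply/eqP; rewrite -[X in _ == X]add0n eqn_add2r -leqn0 leqNgt shuffle_coef_gt0.
  by apply/negP => /(split_block 0); rewrite /= eqxx block_keep ltnn.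
rewrite !add0n add1n subSn ?block_leq //= eqxx mul1n IHu.
suff: forall w, keep_block k.+1 u <> a :: w.
  case: (keep_block _ u) => //= d w dw; case: eqP => [da|] //.
  by case: (dw w); rewrite da.
elim: u {IHu} => //= d u IHu w; have [_|da] := eqVneq d a; first exact: IHu.
by case=> da'; rewrite da' eqxx in da.
Qed.

End Blocks.

(** * Words determined by their splittings *)

Section EqualCoefficients.
Variables (K : nzSemiRingType) (T : eqType) (a : T).
Implicit Types (u v w : seq T).

(** Only proper splittings are compared, as these are the ones that an induction on length
    controls. *)
Definition same_pow_coefs u v := forall r w,
  (0 < r)%N -> w != [::] -> (r + size w)%N = size u ->
  (shuffle_coef u (nseq r a) w)%:R = (shuffle_coef v (nseq r a) w)%:R :> K.

Lemma same_pow_coefs_block u v r w k : same_pow_coefs u v ->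
    (0 < r)%N -> (0 < block a w k)%N ->
    (shuffle_coef u (nseq r a) w)%:R != 0 :> K ->
  (block a w k <= block a v k)%N.
Proof.
move=> uv r_gt0 wk uw; have w_n0 : w != [::] by apply: contraTneq wk => ->.
have : (0 < shuffle_coef u (nseq r a) w)%N by rewrite lt0n; apply: contraNneq uw => ->.
rewrite shuffle_coef_gt0 => /splits_size; rewrite /= size_nseq => size_u.
apply: (@split_block _ a r); rewrite -shuffle_coef_gt0 lt0n.
by apply: contraNneq uw => vw; rewrite uv // vw.
Qed.

(** Otherwise, deleting the [a]'s outside block [k] is a proper splitting of coefficient 1. Carried
    over to [v], it bounds block [k] of [v] from below by that of [u]. *)
Lemma same_pow_coefs_full u v k : same_pow_coefs u v ->
  (block a v k < block a u k)%N -> block a u k = count_mem a u.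
Proof.
move=> uv vuk; apply/eqP; rewrite eqn_leq block_leq leqNgt -subn_gt0 /=.
apply/negP => r_gt0; have := same_pow_coefs_block (w := keep_block a k u) uv r_gt0.
move=> /(_ k); rewrite block_keep shuffle_coef_keep oner_neq0.
by move=> /(_ (leq_ltn_trans (leq0n _) vuk) isT); rewrite leqNgt vuk.
Qed.

(** The block sizes determine the word once its other letters are fixed, and they have the same sum
    in [u] and [v]. *)
Lemma block_ltn u v : filter (predC1 a) u = filter (predC1 a) v ->
    count_mem a u = count_mem a v -> u <> v ->
  exists k, (block a v k < block a u k)%N.
Proof.
move=> f_uv c_uv neq_uv; apply: contrapT => noC; apply: neq_uv.
have le_uv k : (block a u k <= block a v k)%N.
  by rewrite leqNgt; apply/negP => vu; apply: noC; exists k.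
apply: (block_inj f_uv) => k.
have c'_uv : count (predC1 a) v = count (predC1 a) u by rewrite -!size_filter f_uv.
have [k_lt|k_ge] := ltnP (count (predC1 a) u) k; first by rewrite !block_big ?c'_uv.
have leif_uv (i : 'I_(count (predC1 a) u).+1) : true ->
    (block a u i <= block a v i ?= iff (block a u i == block a v i))%N.
  by move=> _; split.
have [_] := leqif_sum leif_uv.
rewrite -sum_block // -sum_block ?c'_uv // c_uv eqxx => /esym/forallP.
by move=> /(_ (Ordinal (k_ge : (k < _.+1)%N)))/eqP.
Qed.

Hypothesis K_nchar : forall p : nat, p \notin [pchar K].

Lemma same_pow_coefs_eq u v :
  filter (predC1 a) u = filter (predC1 a) v -> count_mem a u = count_mem a v ->
  (1 < count_mem a u)%N -> same_pow_coefs u v -> u = v.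
Proof.
move=> f_uv c_uv i_gt1 uv; apply: contrapT => neq_uv.
have [k vuk] := block_ltn f_uv c_uv neq_uv.
have [l uvl] := block_ltn (esym f_uv) (esym c_uv) (fun e => neq_uv (esym e)).
have vu : same_pow_coefs v u.
  move=> r w r_gt0 w_n0 rw; apply/esym/uv => //.
  rewrite rw -(count_predC (pred1 a)) -[RHS](count_predC (pred1 a)) c_uv.
  by congr addn; rewrite -!size_filter f_uv.
have ku := same_pow_coefs_full uv vuk; have lv := same_pow_coefs_full vu uvl.
have vk : block a v k = 0%N.
  apply: block_full lv _; apply: contraTneq uvl => <-.
  by rewrite -leqNgt ltnW.
pose p := take k (filter (predC1 a) u); pose s := drop k (filter (predC1 a) u).
have [p_a s_a] : free_of a p /\ free_of a s.
  by apply/andP; rewrite /free_of -all_cat cat_take_drop filter_all.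
have size_p : size p = k.
  rewrite size_takel // size_filter leqNgt; apply: contraTN vuk => /block_big->.
  by rewrite -leqNgt.
have filter_ps r : filter (predC1 a) (p ++ nseq r a ++ s) = filter (predC1 a) u.
  rewrite !filter_cat (all_filterP p_a) (all_filterP s_a).
  by rewrite [filter _ (nseq _ _)]filter_nseq /= eqxx cat_take_drop.
have u_eq : u = p ++ nseq (count_mem a u) a ++ s.
  apply: (@block_inj _ a) => [|l']; first by rewrite filter_ps.
  rewrite block_insert // size_p; case: eqP => [->|/eqP]; first by rewrite mul1n.
  exact: block_full.
(* Removing [r] of the [a]'s from the single block of [u] has coefficient ['C(i, r)], where [i] is
   the number of [a]'s, and leaves block [k] nonempty, whereas [v] has no [a] there. *)
have [r /andP[r_gt0 ri] Cr] := binomial_neq0 K_nchar i_gt1.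
have := same_pow_coefs_block (w := p ++ nseq (count_mem a u - r) a ++ s) uv r_gt0.
move=> /(_ k); rewrite block_insert // size_p eqxx mul1n subn_gt0 ri vk.
rewrite leqn0 subn_eq0 leqNgt ri => /(_ isT) no_coef.
suff: false by []; apply: no_coef.
rewrite [X in shuffle_coef X]u_eq shuffle_coef_cat //.
move: (count_mem a u) ri Cr => i ri; rewrite -[i](subnKC (ltnW ri)) addKn.
by rewrite shuffle_coef_pow.
Qed.

End EqualCoefficients.

(** * Partial commutations and projections on pairs of letters *)

Section Projections.
Variables (B : choiceType) (theta : rel B).
Hypotheses (theta_sym : symmetric theta) (theta_irr : irreflexive theta).
Implicit Types u v w : word B.

(** As [theta] is irreflexive, the case [a = b] is included and counts the occurrences of each
    letter. *)
Definition same_projections u v := forall a b, ~~ theta a b ->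
  filter (pred2 a b) u = filter (pred2 a b) v.

Lemma same_projections_sym u v : same_projections u v -> same_projections v u.
Proof. by move=> uv a b /uv. Qed.

Lemma same_projections_perm u v : same_projections u v -> perm_eq u v.
Proof.
move=> uv; apply/allP => c _ /=; have := uv c c; rewrite theta_irr => /(_ isT).
move=> /(congr1 size); rewrite !size_filter => uv_c.
by rewrite -!(@eq_count _ (pred2 c c)) ?uv_c // => x; rewrite /= orbb.
Qed.

Lemma same_projections_all (P : pred B) u v : same_projections u v -> all P u = all P v.
Proof. by move=> /same_projections_perm/perm_all. Qed.

Lemma same_projections_size u v : same_projections u v -> size u = size v.
Proof. by move=> /same_projections_perm/perm_size. Qed.

Lemma commutation_same_projections u v :
  gen_rel (commutation_rel theta) u v -> same_projections u v.
Proof.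
elim=> {u v} [_ _ [[c d] /= cd [-> ->]]|u|u v _ uv|u v w _ uv _ vw|w u v _ uv|w u v _ uv] a b ab.
- change (filter (pred2 a b) [:: c; d] = filter (pred2 a b) [:: d; c]) => /=.
  case: (eqVneq c a) => ca; case: (eqVneq c b) => cb;
  case: (eqVneq d a) => da; case: (eqVneq d b) => db; rewrite //=;
    by subst; move: ab; rewrite ?cd // theta_sym cd.
- by [].
- by rewrite uv.
- by rewrite uv // vw.
- by rewrite !filter_cat uv.
- by rewrite !filter_cat uv.
Qed.

Lemma commute_letter a p s : all (theta a) p ->
  gen_rel (commutation_rel theta) (p ++ a :: s) (a :: p ++ s).
Proof.
elim: p => /= [|c p IHp]; first by move=> _; apply: GenRefl.
case/andP=> ac /IHp {}IHp; apply: (@GenTrans (word B) _ _ (c :: a :: p ++ s)).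
  exact: (@GenMull (word B) _ [:: c] (p ++ a :: s) (a :: p ++ s)).
apply: (@GenMulr (word B) _ (p ++ s) [:: c; a] [:: a; c]); apply: GenBase.
by exists (c, a); rewrite //= theta_sym.
Qed.

(** The first letter [a] of [u] can be pulled to the front of [v]: if some [c] before the first [a]
    of [v] did not commute with it, the projections on [a] and [c] would start with different
    letters. *)
Lemma same_projections_commutation u v :
  same_projections u v -> gen_rel (commutation_rel theta) u v.
Proof.
elim: u v => [|a u IHu] v uv.
  by have /same_projections_size/esym/size0nil-> := uv; apply: GenRefl.
have av : a \in v by rewrite -(perm_mem (same_projections_perm uv)) mem_head.
pose p := take (index a v) v; pose s := drop (index a v).+1 v.
have v_eq : v = p ++ a :: s.
  by rewrite -{1}(cat_take_drop (index a v) v) (drop_nth a) ?index_mem // nth_index.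
have ap : a \notin p by rewrite in_take_leq ?index_size // ltnn.
have theta_p : all (theta a) p.
  apply/allP => c cp; apply: contraLR ap => ac; have := uv _ _ ac.
  rewrite v_eq /= eqxx filter_cat negbK.
  have : c \in filter (pred2 a c) p by rewrite mem_filter cp /= eqxx orbT.
  have : {subset filter (pred2 a c) p <= p} by apply: mem_subseq; apply: filter_subseq.
  by case: (filter _ p) => //= e q sub _ [-> _]; apply: sub; rewrite mem_head.
have vE := commute_letter s theta_p; rewrite v_eq.
apply: (@GenTrans (word B) _ _ (a :: p ++ s)); last exact: GenSym vE.
apply: (@GenMull (word B) _ [:: a] u (p ++ s)); apply: IHu => b c bc.
have := uv _ _ bc; rewrite {1}v_eq (commutation_same_projections vE bc) /=.
by case: ifP => // _ [].
Qed.

End Projections.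

(** * Words with the same image *)

Section CompatibleMorphism.
Variables (K : nzSemiRingType) (B : choiceType) (M : monoidType).
Variable g : word B -> M.
Implicit Types u v w : word B.

Definition image_coef u w w' :=
  count (fun x => (g x.1, g x.2) == (g w, g w')) (splits u).

Hypothesis g1 : g [::] = 1%g.
Hypothesis g_coef : forall u v w w', g u = g v ->
  (image_coef u w w')%:R = (image_coef v w w')%:R :> K.

(** For a shortest such [u], only the two extreme splittings contribute to [1 (x) 1], against one
    for the empty word. *)
Lemma two_eq_one u : u != [::] -> g u = 1%g -> 2%:R = 1%:R :> K.
Proof.
have [n] := ubnP (size u); elim: n u => // n IHn u u_n u0 gu.
have [/hasP[x]|no_x] :=
    boolP (has (fun x => proper_split x && (g x.1 == 1%g)) (splits u)).
  move=> /splits_size xu /andP[/andP[x1 x2] /eqP gx]; apply: (IHn x.1) => //.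
  by rewrite -ltnS (leq_trans _ u_n) // ltnS -xu -addn1 leq_add2l lt0n size_eq0.
have := @g_coef u [::] [::] [::]; rewrite g1 => /(_ gu).
rewrite /image_coef (permP (splits_proper u0)) /= gu g1 eqxx add1n add1n.
rewrite count_filter (@eq_in_count _ _ pred0) ?count_pred0 // => x xu /=.
apply: contraNF no_x => /andP[/eqP[gx1 _] x_proper]; apply/hasP; exists x => //.
by rewrite x_proper gx1 eqxx.
Qed.

Hypothesis g_letter_neq1 : forall a, g [:: a] != 1%g.

(** Otherwise every positive integer is 1 in [K] by [two_eq_one]. So splitting off the first letter
    has coefficient 1, while the empty word has no such splitting. *)
Lemma image_neq1 u : u != [::] -> g u != 1%g.
Proof.
move=> u0; apply/eqP => gu; have K21 := two_eq_one u0 gu.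
have K_nat n : n.+1%:R = 1 :> K.
  by elim: n => // n IHn; rewrite -natr1 IHn -[RHS]K21.
case: u u0 gu => // a u _ gu.
have := @g_coef (a :: u) [::] [:: a] u; rewrite g1 => /(_ gu).
rewrite [X in _ = X%:R](_ : _ = 0%N); last first.
  by rewrite /image_coef /= g1 xpair_eqE eq_sym (negPf (g_letter_neq1 a)).
have /hasP : exists2 x, x \in splits (a :: u) & (g x.1, g x.2) == (g [:: a], g u).
  exists ([:: a], u); rewrite //= mem_cat; apply/orP; left.
  by apply/mapP; exists ([::], u); rewrite ?splits_r.
rewrite has_count -/(image_coef _ _ _); case: (image_coef _ _ _) => // n _.
by move=> /eqP; rewrite K_nat oner_eq0.
Qed.

Hypothesis g_letter_inj : injective (fun a => g [:: a]).
Hypothesis K_nchar : forall p : nat, p \notin [pchar K].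

Definition commuting_letters : rel B :=
  fun a b => (a != b) && (g [:: a; b] == g [:: b; a]).

Lemma commuting_letters_sym : symmetric commuting_letters.
Proof. by move=> a b; rewrite /commuting_letters eq_sym [X in _ && X]eq_sym. Qed.

Lemma commuting_letters_irr : irreflexive commuting_letters.
Proof. by move=> a; rewrite /commuting_letters eqxx. Qed.

Local Notation theta := commuting_letters.
Local Notation irr := commuting_letters_irr.

Section InductionStep.
Variable n : nat.
Hypothesis IHn : forall w w', (size w < n)%N -> (size w' < n)%N ->
  g w = g w' -> same_projections theta w w'.

Definition small w := (w != [::]) && (size w < n)%N.

(** By [image_neq1] both parts of [x] are nonempty, hence short enough for [IHn]. *)
Lemma image_small v x w w' : (size v <= n)%N -> x \in splits v ->
  small w -> small w' -> (g x.1, g x.2) = (g w, g w') ->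
  same_projections theta x.1 w /\ same_projections theta x.2 w'.
Proof.
move=> v_n xv /andP[w0 wn] /andP[w0' wn'] [gw gw'].
have x1 : x.1 != [::].
  by apply: contraTneq (image_neq1 w0) => x1; rewrite -gw x1 g1 eqxx.
have x2 : x.2 != [::].
  by apply: contraTneq (image_neq1 w0') => x2; rewrite -gw' x2 g1 eqxx.
rewrite -size_eq0 -lt0n in x1; rewrite -size_eq0 -lt0n in x2.
split; apply: IHn => //; apply: leq_trans v_n; rewrite -(splits_size xv).
  by rewrite -addn1 leq_add2l.
by rewrite -add1n leq_add2r.
Qed.

Lemma image_split u v w w' : g u = g v -> (size v <= n)%N ->
  small w -> small w' -> (image_coef u w w')%:R != 0 :> K ->
  exists2 x, x \in splits v &
    same_projections theta x.1 w /\ same_projections theta x.2 w'.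
Proof.
move=> guv v_n w_n w_n' uw.
have : (0 < image_coef v w w')%N.
  by rewrite lt0n; apply: contraNneq uw => vw; rewrite (g_coef _ _ guv) vw.
rewrite -has_count => /hasP[x xv /eqP xw]; exists x => //.
exact: (image_small v_n xv w_n w_n' xw).
Qed.

(** Equal projections preserve the set of letters, so among the splittings of [u] only the one along
    [P] has this image. Its coefficient 1 yields a splitting of [v], which is again the one along
    [P]. *)
Lemma image_filter u v (P : pred B) : g u = g v -> size u = n ->
  (size v <= n)%N -> has P u -> has (predC P) u ->
  same_projections theta (filter P v) (filter P u) /\
  same_projections theta (filter (predC P) v) (filter (predC P) u).
Proof.
move=> guv u_n v_n Pu P'u.
have w_n : small (filter P u).
  rewrite /small -has_filter Pu size_filter -u_n -(count_predC P u) -addn1.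
  by rewrite leq_add2l -has_count.
have w_n' : small (filter (predC P) u).
  rewrite /small -has_filter P'u size_filter -u_n -(count_predC P u) -add1n.
  by rewrite leq_add2r -has_count.
have P_split (x : word B * word B) : same_projections theta x.1 (filter P u) ->
    same_projections theta x.2 (filter (predC P) u) ->
    all P x.1 && all (predC P) x.2.
  move=> /(same_projections_all irr) -> /(same_projections_all irr) ->.
  by rewrite !filter_all.
have [|x xv [x1 x2]] := image_split guv v_n w_n w_n'.
  rewrite [X in X%:R](_ : _ = 1%N) ?oner_neq0 //.
  rewrite -(splits_filter P u).1; apply: eq_in_count => x xu.
  apply/eqP/andP => [/(image_small (eq_leq u_n) xu w_n w_n')[x1 x2]|[x1 x2]].
    exact/andP/P_split.
  by rewrite (splits_filterP xu x1 x2).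
have /andP[Px1 Px2] := P_split _ x1 x2.
by move: x1 x2; rewrite (splits_filterP xv Px1 Px2).
Qed.

(** For words in [c] and [d] alone, equal projections mean equal words. *)
Lemma image_coef_pair u w w' c d : (size u <= n)%N -> ~~ theta c d ->
    all (pred2 c d) u -> all (pred2 c d) w -> all (pred2 c d) w' ->
    small w -> small w' ->
  image_coef u w w' = shuffle_coef u w w'.
Proof.
move=> u_n cd u_cd w_cd w_cd' w_n w_n'; apply: eq_in_count => x xu.
apply/eqP/eqP => [/(image_small u_n xu w_n w_n')[/(_ _ _ cd) x1 /(_ _ _ cd) x2]|-> //].
have /andP[x1_cd x2_cd] := splits_all xu u_cd.
move: x1 x2; rewrite !(all_filterP _) // => x1 x2.
by rewrite [x]surjective_pairing x1 x2.
Qed.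

Lemma image_constant u v a : g u = g v -> size u = n -> (size v <= n)%N ->
  all (pred1 a) u -> u = v.
Proof.
move=> guv u_n v_n u_a.
have u_eq : u = nseq n a by rewrite -u_n; apply/all_pred1P.
case: (ltngtP n 1) => n1.
- have n0 : n = 0%N by case: (n) n1.
  by rewrite n0 leqn0 size_eq0 in v_n; rewrite u_eq n0 (eqP v_n).
- have [k /andP[k_gt0 kn] Ck] := binomial_neq0 K_nchar n1.
  have w_n : small (nseq k a) by rewrite /small size_nseq kn andbT; case: (k) k_gt0.
  have w_n' : small (nseq (n - k) a).
    rewrite /small size_nseq -size_eq0 size_nseq -lt0n subn_gt0 kn.
    by rewrite ltn_subrL k_gt0 (leq_trans _ n1).
  have nseq_a m : all (pred2 a a) (nseq m a).
    by apply/allP => c /nseqP[-> _]; rewrite /= eqxx.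
  have [|x xv [x1 x2]] := image_split guv v_n w_n w_n'.
    rewrite (@image_coef_pair _ _ _ a a) ?irr ?nseq_a ?u_n //; last first.
      by rewrite u_eq nseq_a.
    have := @shuffle_coef_pow _ a k (n - k) [::] isT.
    by rewrite !cats0 subnKC ?(ltnW kn) // u_eq => ->.
  have v_a : all (pred1 a) v.
    rewrite -(perm_all _ (splits_perm xv)) all_cat.
    rewrite (same_projections_all irr _ x1) (same_projections_all irr _ x2).
    by rewrite !all_nseq /= eqxx !orbT.
  have -> : v = nseq (size v) a by apply/all_pred1P.
  rewrite -(splits_size xv) (same_projections_size irr x1).
  by rewrite (same_projections_size irr x2) !size_nseq subnKC // ltnW.
case: v guv v_n => [|b [|c v]] guv v_n; last by rewrite n1 in v_n.
  by have := image_neq1 (_ : u != [::]); rewrite u_eq n1 in guv *; rewrite guv g1 eqxx => /(_ isT).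
by rewrite u_eq n1 in guv *; congr [:: _]; apply: g_letter_inj.
Qed.

Lemma image_two_letters u v c d : g u = g v -> size u = n -> size v = n ->
    ~~ theta c d -> c != d -> all (pred2 c d) u -> all (pred2 c d) v ->
    perm_eq u v -> (1 < count_mem c u)%N -> u = v.
Proof.
move=> guv u_n v_n th_cd cd u_cd v_cd uv c_u.
have c' w : all (pred2 c d) w -> filter (predC1 c) w = nseq (count (predC1 c) w) d.
  move=> w_cd; rewrite -size_filter; apply/all_pred1P; rewrite all_filter.
  by apply: sub_all w_cd => x /orP[/eqP->|/eqP->] /=; rewrite eqxx // implybT.
apply: (@same_pow_coefs_eq K _ c) => //; first by rewrite !c' // (permP uv).
  by rewrite (permP uv).
move=> r w r_gt0 w0 rw; have [w_cd|w_cd] := boolP (all (pred2 c d) w).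
  have r_cd : all (pred2 c d) (nseq r c) by rewrite all_nseq /= eqxx orbT.
  have r_n : small (nseq r c).
    rewrite /small -size_eq0 size_nseq -lt0n r_gt0 -u_n -rw -addn1 leq_add2l.
    by rewrite lt0n size_eq0.
  have w_n : small w by rewrite /small w0 -u_n -rw -add1n leq_add2r.
  by rewrite -!(@image_coef_pair _ _ _ c d) ?u_n ?v_n //; apply: g_coef.
have coef0 u' : all (pred2 c d) u' -> shuffle_coef u' (nseq r c) w = 0%N.
  move=> u'_cd; apply/eqP; rewrite -leqn0 leqNgt shuffle_coef_gt0.
  by apply: contra w_cd => /splits_all-/(_ _ u'_cd)/andP[].
by rewrite !coef0.
Qed.

Lemma image_step u v : g u = g v -> size u = n -> (size v <= n)%N ->
  same_projections theta u v.
Proof.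
move=> guv u_n v_n.
case: (u =P [::]) => [u0|]; first by move: u_n v_n; rewrite u0 => <-; case: (v).
case Du: {1}u => [//|e u'] _.
have [u_e|u_e] := boolP (all (pred1 e) u); first by rewrite (image_constant guv _ _ u_e).
have e_u : has (pred1 e) u by rewrite Du /= eqxx.
(* Cutting [u] into its [e]'s and the rest, both nonempty, shows that [v] is a rearrangement of
   [u]. *)
have uv : perm_eq u v.
  rewrite -has_predC in u_e; have [f1 f2] := image_filter guv u_n v_n e_u u_e.
  rewrite -(permPl (permEl (perm_filterC (pred1 e) u))).
  rewrite -(permPr (permEl (perm_filterC (pred1 e) v))) perm_sym.
  exact: perm_cat (same_projections_perm irr f1) (same_projections_perm irr f2).
have v_n' : size v = n by rewrite -(perm_size uv).
move=> c d cd; have [P'u|u_cd] := boolP (has (predC (pred2 c d)) u); last first.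
  rewrite has_predC negbK in u_cd.
  have v_cd : all (pred2 c d) v by rewrite -(perm_all _ uv).
  suff -> : u = v by [].
  have both x y : all (pred2 x y) u -> y \in u.
    move=> u_xy; apply: contraR u_e => yu; apply/allP => z zu.
    have u_x z' : z' \in u -> z' = x.
      by move=> zu'; have /orP[/eqP //|/eqP z'y] := allP u_xy _ zu'; rewrite -z'y zu' in yu.
    by rewrite (u_x z zu) (u_x e) ?Du ?mem_head //= .
  have u_dc : all (pred2 d c) u by apply: sub_all u_cd => x; rewrite /= orbC.
  have v_dc : all (pred2 d c) v by apply: sub_all v_cd => x; rewrite /= orbC.
  have du := both _ _ u_cd; have cu := both _ _ u_dc.
  have neq_cd : c != d.
    apply: contraNneq u_e => cd'; apply/allP => z zu.
    have := allP u_cd e; rewrite {1}Du mem_head => /(_ isT).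
    by have := allP u_cd z zu; rewrite /= cd' !orbb => /eqP-> /eqP->.
  have [c1|c1] := ltnP 1 (count_mem c u); first exact: (@image_two_letters u v c d).
  have [d1|d1] := ltnP 1 (count_mem d u).
    by apply: (@image_two_letters u v d c); rewrite // 1?commuting_letters_sym // eq_sym.
  (* Now [c] and [d] occur once each, and the two possible words have different images since [c] and
     [d] do not commute. *)
  have count1 x : x \in u -> (count_mem x u <= 1)%N -> count_mem x u = 1%N.
    by rewrite -has_pred1 has_count => x0 x1; apply/eqP; rewrite eqn_leq x1.
  have size2 w : perm_eq w [:: c; d] -> w = [:: c; d] \/ w = [:: d; c].
    move=> w2; have := perm_size w2; case: w w2 => [|x [|y [|z w]]] // w2 _.
    have xcd : x \in [:: c; d] by rewrite -(perm_mem w2) mem_head.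
    rewrite !inE in xcd; case/orP: xcd w2 => /eqP->.
      by rewrite perm_cons => /perm_mem/(_ y); rewrite !inE eqxx => /esym/eqP->; left.
    rewrite perm_sym (perm_catCA [:: c] [:: d] [::]) perm_cons => /perm_mem/(_ y).
    by rewrite !inE eqxx => /eqP->; right.
  have u_perm : perm_eq u [:: c; d].
    apply/allP => x; rewrite mem_cat => x_in /=.
    have /orP[/eqP->|/eqP->] : pred2 c d x.
      by case/orP: x_in => [/(allP u_cd)//|]; rewrite !inE.
      by rewrite count1 // eqxx [d == c]eq_sym (negPf neq_cd).
    by rewrite count1 // eqxx (negPf neq_cd).
  have v_perm : perm_eq v [:: c; d] by rewrite -(permPl uv).
  have no_comm : g [:: c; d] <> g [:: d; c].
    by move=> /eqP gcd; rewrite /commuting_letters neq_cd gcd in cd.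
  by have [ue|ue] := size2 _ u_perm; have [ve|ve] := size2 _ v_perm;
    rewrite ue ve // in guv *; case: no_comm.
have [Pu|Pu] := boolP (has (pred2 c d) u).
  have [f1 _] := image_filter guv u_n v_n Pu P'u.
  by have := f1 _ _ cd; rewrite !filter_id.
have Pv : ~~ has (pred2 c d) v by rewrite -(perm_has _ uv).
by move: Pu Pv; rewrite !has_filter !negbK => /eqP-> /eqP->.
Qed.

End InductionStep.

Lemma image_eq_projections u v : g u = g v -> same_projections theta u v.
Proof.
have [n] := ubnP (maxn (size u) (size v)).
elim: n u v => // n IHn u v; rewrite ltnS geq_max => /andP[u_n v_n] guv.
have IH w w' : (size w < n)%N -> (size w' < n)%N -> g w = g w' ->
    same_projections theta w w'.
  by move=> w_n w'_n; apply: IHn; rewrite gtn_max w_n.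
have [u_lt|u_ge] := ltnP (size u) n; last first.
  by apply: (image_step IH) => //; apply/eqP; rewrite eqn_leq u_n.
have [v_lt|v_ge] := ltnP (size v) n; first exact: IH.
by apply/same_projections_sym/(image_step IH) => //; apply/eqP; rewrite eqn_leq v_n.
Qed.

End CompatibleMorphism.

(** * The quotient as a partially commutative monoid *)

Section PartiallyCommutative.
Variables (K : nzSemiRingType) (A : choiceType) (E : congruence (word A)).
Hypothesis E_shuffle : shuffle_compatible K E.

Lemma image_coef_quot (u v w w' : word A) : quot_proj E u = quot_proj E v ->
  (image_coef (quot_proj E) u w w')%:R = (image_coef (quot_proj E) v w w')%:R :> K.
Proof.
move=> /quot_projP; have /shuffle_compatibleP cE := E_shuffle.
move=> /cE/(congr1 (malg_coef (quot_proj E w, quot_proj E w'))).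
by rewrite !quot_coprod_count.
Qed.

(** Dropping the trivial class and identifying equivalent letters makes the generators nontrivial
    and distinct in the quotient. *)
Definition letter_classes : pred (quot_monoid E) :=
  fun x => (x != 1%g) && `[< exists a, x = quot_proj E (letter a) >].

Local Notation B := {x : quot_monoid E | letter_classes x}.

Lemma letter_class_lift (b : B) : exists a, val b = quot_proj E (letter a).
Proof. by case: b => x /= /andP[_ /asboolP]. Qed.

Definition lift_letter (b : B) : A := sval (cid (letter_class_lift b)).

Lemma lift_letterE b : quot_proj E (letter (lift_letter b)) = val b.
Proof. by rewrite /lift_letter; case: cid. Qed.

Definition class_word (w : word B) : quot_monoid E :=
  quot_proj E (map lift_letter w : word A).

Lemma class_wordM : {morph class_word : u v / (u * v)%g}.
Proof. by move=> u v; rewrite /class_word [map _ _]map_cat; apply: quot_projM. Qed.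

Lemma class_word_surj x : exists w, class_word w = x.
Proof.
rewrite -[x]quot_reprK; elim: (quot_repr x : seq A) => [|a w [v wv]].
  by exists [::].
have wE : quot_proj E (a :: w) = (quot_proj E (letter a) * quot_proj E w)%g.
  exact: (quot_projM E (letter a) w).
have [a1|a1] := eqVneq (quot_proj E (letter a)) 1%g.
  by exists v; rewrite wE a1 mul1g.
have aB : letter_classes (quot_proj E (letter a)).
  by rewrite /letter_classes a1; apply/asboolP; exists a.
pose b : B := Sub _ aB; exists (letter b * v)%g; rewrite class_wordM wv wE; congr (_ * _)%g.
exact: lift_letterE.
Qed.

Hypothesis K_nchar : forall p : nat, p \notin [pchar K].

Lemma quot_partially_commutative : partially_commutative (quot_monoid E).
Proof.
pose theta := commuting_letters class_word.
have th_sym : symmetric theta := commuting_letters_sym _.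
have th_irr : irreflexive theta := commuting_letters_irr _.
exists B, theta; split=> //.
have wordP u v : class_word u = class_word v <-> gen_rel (commutation_rel theta) u v.
  split=> [uv|].
    apply: same_projections_commutation => //.
    apply: (@image_eq_projections K) => //; first last.
    - by move=> b c; rewrite ![class_word _]lift_letterE => /val_inj.
    - by move=> b; rewrite [class_word _]lift_letterE; case/andP: (valP b).
    move=> {u v uv} u v w w' uv.
    have := image_coef_quot (map lift_letter w) (map lift_letter w') uv.
    by rewrite /image_coef !splits_map !count_map.
  elim=> // {u v} [u v [[a b] /= /andP[_ /eqP ab] [-> ->]]|u v w _ -> //|w u v _ uv|w u v _ uv].
  - exact: ab.
  - by rewrite !class_wordM uv.
  - by rewrite !class_wordM uv.
pose e x : word B := sval (cid (class_word_surj x)).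
have eK x : class_word (e x) = x by rewrite /e; case: cid.
exists (fun x => quot_proj _ (e x)); split.
- by apply/quot_projP/wordP; rewrite eK.
- move=> x y; apply: etrans (quot_projM _ _ _).
  by apply/quot_projP/wordP; rewrite class_wordM !eK.
exists (fun y => class_word (quot_repr y)) => [x|y].
  rewrite -[RHS]eK; apply/wordP.
  exact/(quot_projP (gen_congr (commutation_rel theta)))/quot_reprK.
rewrite -[RHS]quot_reprK; apply/quot_projP/wordP.
by rewrite eK.
Qed.

End PartiallyCommutative.

(** The opposite of [x] is [p.-1] times [x]. *)
Lemma pchar_is_ring (K : nzSemiRingType) p : p \in [pchar K] -> is_ring K.
Proof.
move=> pK x; exists (p.-1%:R * x); rewrite -{1}[x]mul1r -mulrDl.
have p_gt0 : (0 < p)%N by rewrite prime_gt0 // (pcharf_prime pK).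
by rewrite nat1r prednK // pcharf0 // mul0r.
Qed.

(** * Comparing a congruence with one that agrees on short words *)

Section Layers.
Variables (K : nzSemiRingType) (A : choiceType) (E : congruence (word A)).
Hypotheses (K_ring : is_ring K) (E_shuffle : shuffle_compatible K E).

(** In a ring, the equation [2 = 1] of [two_eq_one] forces [1 = 0]. *)
Lemma ring_one_class u : E [::] u -> u = [::].
Proof.
move=> Eu; apply/eqP; apply: contraT => u0.
have : 2%:R = 1%:R :> K.
  apply: (@two_eq_one K A _ (quot_proj E)) u0 _ => //.
    exact: image_coef_quot.
  exact/quot_projP/congr_sym.
have [y y1] := K_ring 1 => /(congr1 (+%R y)).
by rewrite -natr1 addrCA [y + _]addrC y1 addr0 => /eqP; rewrite oner_eq0.
Qed.

Variable s : seq A.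

Lemma quot_coprod_proper (G : congruence (word A)) u : u != [::] ->
  quot_coprod K G u =
  malg_single K (quot_proj G u, 1%g) + malg_single K (1%g, quot_proj G u) +
  \sum_(x <- splits u | proper_split x) malg_single K (quot_proj G x.1, quot_proj G x.2).
Proof.
move=> u0; rewrite /quot_coprod (perm_big _ (splits_proper u0)) !big_cons /=.
by rewrite big_filter addrA.
Qed.

Section Agreement.
Variables (G : congruence (word A)) (i : nat).
Hypothesis EG : forall w w' : word A, all (mem s) w -> all (mem s) w' ->
  (size w < i)%N -> (size w' < i)%N -> E w w' -> G w w'.

Lemma sum_splits_agree (S S' : seq (word A * word A)) :
  {in S ++ S', forall x, [&& all (mem s) x.1, all (mem s) x.2,
                             (size x.1 < i)%N & (size x.2 < i)%N]} ->
  \sum_(x <- S) malg_single K (quot_proj E x.1, quot_proj E x.2) =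
  \sum_(x <- S') malg_single K (quot_proj E x.1, quot_proj E x.2) ->
  \sum_(x <- S) malg_single K (quot_proj G x.1, quot_proj G x.2) =
  \sum_(x <- S') malg_single K (quot_proj G x.1, quot_proj G x.2).
Proof.
move=> small_S.
apply: (@sum_single_factor K _ _ _ (fun x => (quot_proj E x.1, quot_proj E x.2))
  (fun x => (quot_proj G x.1, quot_proj G x.2))) => x y.
move=> /small_S/and4P[x1 x2 x1_i x2_i] /small_S/and4P[y1 y2 y1_i y2_i].
by case=> /quot_projP e1 /quot_projP e2; congr pair; apply/quot_projP; apply: EG.
Qed.

Lemma quot_coprod_agree u v : all (mem s) u -> all (mem s) v ->
  (size u < i)%N -> (size v < i)%N -> E u v -> quot_coprod K G u = quot_coprod K G v.
Proof.
move=> u_s v_s u_i v_i Euv; apply: sum_splits_agree.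
  move=> x; rewrite mem_cat.
  have small_x (w : word A) : all (mem s) w -> (size w < i)%N -> x \in splits w ->
      [&& all (mem s) x.1, all (mem s) x.2, (size x.1 < i)%N & (size x.2 < i)%N].
    move=> w_s w_i xw; have /andP[-> ->] := splits_all xw w_s.
    by rewrite !(leq_ltn_trans _ w_i) // -(splits_size xw) ?leq_addr ?leq_addl.
  by case/orP; apply: small_x.
by have /shuffle_compatibleP := E_shuffle; apply.
Qed.

(** Over [E] the extreme tensors of [u] and [v] coincide and cancel, so the sums over proper
    splittings agree. These involve only words shorter than [i], so they agree over [G] too and
    vanish from the coproduct of [d]. *)
Lemma primitive_agree u v d : all (mem s) u -> all (mem s) v ->
    (size u <= i)%N -> (size v <= i)%N -> E u v -> shuffle_compatible K G ->
    is_difference (malg_single K u) (malg_single K v) d ->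
  primitive (nat_map G d).
Proof.
move=> u_s v_s u_i v_i Euv [c cG] d_uv; exists c => //.
have tens1l P : tens (1 : malg K (quot_monoid G)) P
    = linext (fun x : quot_monoid G => malg_single K (1%g, x)) P.
  exact: linext_single.
case: (eqVneq u v) => [uv|neq_uv].
  have -> : d = 0.
    apply: (@malg_addIr _ _ K_ring (malg_single K v)).
    by rewrite addr0 addrC d_uv uv.
  by rewrite !raddf0 tens1l raddf0 addr0 [tens 0 1]raddf0.
have u0 : u != [::].
  apply: contraNneq neq_uv => u0; apply/eqP.
  by rewrite u0 [RHS]ring_one_class // -u0.
have v0 : v != [::].
  apply: contraNneq neq_uv => v0; apply/eqP.
  by rewrite v0 [LHS]ring_one_class // -v0; apply: congr_sym.
have proper_uv : \sum_(x <- splits u | proper_split x)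
      malg_single K (quot_proj G x.1, quot_proj G x.2) =
    \sum_(x <- splits v | proper_split x)
      malg_single K (quot_proj G x.1, quot_proj G x.2).
  rewrite -[LHS]big_filter -[RHS]big_filter; apply: sum_splits_agree => [x|].
    have small_x (w : word A) : all (mem s) w -> (size w <= i)%N ->
        x \in filter (@proper_split A) (splits w) ->
        [&& all (mem s) x.1, all (mem s) x.2, (size x.1 < i)%N & (size x.2 < i)%N].
      move=> w_s w_i; rewrite mem_filter => /andP[/andP[x1 x2] xw].
      have /andP[-> ->] := splits_all xw w_s.
      rewrite -size_eq0 -lt0n in x1; rewrite -size_eq0 -lt0n in x2.
      rewrite !(leq_trans _ w_i) // -(splits_size xw).
        by rewrite -add1n leq_add2r.
      by rewrite -addn1 leq_add2l.
    by rewrite mem_cat => /orP[]; apply: small_x.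
  rewrite !big_filter; have /shuffle_compatibleP/(_ _ _ Euv) := E_shuffle.
  rewrite !quot_coprod_proper // (proj2 (quot_projP E u v) Euv).
  exact: malg_addIr.
set D := nat_map G d; set V := nat_map G (malg_single K v).
set S := \sum_(x <- splits v | _) _ in proper_uv.
have nat_uv : nat_map G (malg_single K u) = D + V by rewrite -raddfD d_uv.
have cE w : w != [::] -> c (nat_map G (malg_single K w)) =
    tens (nat_map G (malg_single K w)) 1 + tens 1 (nat_map G (malg_single K w)) +
    \sum_(x <- splits w | proper_split x)
      malg_single K (quot_proj G x.1, quot_proj G x.2).
  move=> w0; rewrite cG quot_coprodE quot_coprod_proper // tens1l.
  by rewrite /nat_map !linext_single /tens !linext_single.
have cDV : c D + c V = c (D + V) by rewrite raddfD.
(* As [d] is known only through [d + v = u], the coproduct of [v] is added to both sides. *)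
apply: (@malg_addIr _ _ K_ring (c V)); rewrite addrC cDV -nat_uv cE // proper_uv.
rewrite nat_uv (cE v) // -/V -/S !tens1l [tens (D + V) 1]raddfD raddfD /=.
by rewrite [RHS]addrAC addrACA [X in X + S]addrC.
Qed.

End Agreement.
End Layers.

(** * Generators layered by length, and the theorem *)

Fixpoint words_upto (A : choiceType) (s : seq A) (n : nat) : seq (word A) :=
  if n is n'.+1 then [::] :: [seq a :: w | a <- s, w <- words_upto s n']
  else [:: [::]].

Lemma mem_words_upto (A : choiceType) (s : seq A) n (w : word A) :
  (w \in words_upto s n) = all (mem s) w && (size w <= n)%N.
Proof.
elim: n w => [|n IHn] [|a w] //=; rewrite ?inE ?andbF // ltnS -andbA -IHn.
apply/allpairsP/andP => [[[b v] /= [bs vn [-> ->]]]|[a_s wn]] //.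
by exists (a, w).
Qed.

Lemma fgen_congr_sub (M : monoidType) (R : {fset M * M}) (E : congruence M) :
  (forall x, x \in R -> E x.1 x.2) -> forall u v, fgen_congr R u v -> E u v.
Proof.
move=> RE u v; elim=> {u v} [u v /RE //|u|u v _|u v w _ uv _|w u v _|w u v _].
- exact: congr_refl.
- exact: congr_sym.
- exact: congr_trans.
- exact: congr_mull.
- exact: congr_mulr.
Qed.

Theorem theorem1 (K : nzSemiRingType) (A : choiceType)
    (E : congruence (word A)) (E_fg : finitely_generated E)
    (E_shuffle : shuffle_compatible K E) :
  (~ is_ring K \/ (is_ring K /\ forall p : nat, p \notin [pchar K]) ->
     partially_commutative (quot_monoid E))
  /\
  (forall p : nat, is_ring K -> p \in [pchar K] ->
     exists (R : {fset word A * word A}) (n : nat)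
            (R_ : 'I_n -> {fset word A * word A}),
       let E_ (i : 'I_n) := fgen_congr (\bigcup_(j in 'I_n | (j < i)%N) R_ j)%fset in
       [/\ generates R E,
           is_partition R R_,
           forall i : 'I_n, shuffle_compatible K (E_ i) &
           forall (i : 'I_n) (u v : word A), (u, v) \in R_ i ->
             exists2 d : malg K (word A),
               is_difference (malg_single K u) (malg_single K v) d &
               primitive (nat_map (E_ i) d)]).
Proof.
split=> [K_char|p K_ring _].
  apply: quot_partially_commutative E_shuffle _ => p; apply/negP => pK.
  by case: K_char => [[]|[_ /(_ p)/negP[]//]]; apply: pchar_is_ring pK.
have [R0 R0E] := E_fg.
(* Restricting to the letters of the generating pairs keeps the layers finite even if [A] is
   infinite. *)
pose s := flatten [seq (x.1 : seq A) ++ x.2 | x <- R0].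
pose max_size (x : word A * word A) := maxn (size x.1) (size x.2).
pose L := \max_(x <- R0) max_size x.
have R0_s x : x \in R0 -> all (mem s) x.1 && all (mem s) x.2.
  move=> xR; rewrite -all_cat; apply/allP => a ax; apply/flattenP.
  by exists (x.1 ++ x.2) => //; apply/mapP; exists x.
have R0_L x : x \in R0 -> (max_size x <= L)%N.
  by move=> xR; apply: leq_bigmax_seq.
(* Layers are indexed by the greater of the two lengths, hence disjoint. Diagonal pairs are kept, so
   that no layer up to [L] is empty. *)
pose layer i : {fset word A * word A} :=
  [fset x in [seq (u, v) | u <- words_upto s i, v <- words_upto s i]
     | (max_size x == i) && `[< E x.1 x.2 >]]%fset.
have in_layer i x : x \in layer i <->
    [/\ all (mem s) x.1, all (mem s) x.2, max_size x = i & E x.1 x.2].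
  rewrite !inE /=; split=> [/andP[x_i /andP[/eqP x_max /asboolP Ex]]|].
    have /allpairsP[[u v] [/=]] := x_i; rewrite !mem_words_upto.
    by move=> /andP[u_s _] /andP[v_s _] x_eq; split=> //; rewrite x_eq.
  case=> x1 x2 x_max Ex; rewrite x_max eqxx; apply/andP; split; last exact/asboolP.
  apply/allpairsP; exists x; rewrite !mem_words_upto x1 x2 -x_max.
  by rewrite leq_maxl leq_maxr; case: (x).
pose R_ (i : 'I_L.+1) := layer i.
pose R := (\bigcup_(i in 'I_L.+1) R_ i)%fset.
exists R, L.+1, R_ => E_.
have E_agree (i : 'I_L.+1) (w w' : word A) : all (mem s) w -> all (mem s) w' ->
    (size w < i)%N -> (size w' < i)%N -> E w w' -> E_ i w w'.
  move=> w_s w_s' w_i w_i' Eww'; apply: GenBase.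
  have max_i : (max_size (w, w') < i)%N by rewrite gtn_max w_i.
  apply/bigfcupP; exists (Ordinal (ltn_trans max_i (ltn_ord i))).
    by rewrite mem_index_enum.
  exact/in_layer.
have E_compat (i : 'I_L.+1) : shuffle_compatible K (E_ i).
  apply: shuffle_compatible_gen => u v /bigfcupP[j /andP[_ ji] /in_layer[/= u_s v_s uv_j Euv]].
  have uv_i : (max_size (u, v) < i)%N by rewrite uv_j.
  move: uv_i; rewrite gtn_max => /andP[u_i v_i].
  exact: (@quot_coprod_agree K A E E_shuffle s (E_ i) i (@E_agree i)).
split=> //.
- move=> u v; rewrite R0E; split; apply: fgen_congr_sub => x.
    move=> xR; apply: GenBase; apply/bigfcupP.
    exists (inord (max_size x)); first by rewrite mem_index_enum.
    have /andP[x1 x2] := R0_s x xR.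
    apply/in_layer; rewrite inordK ?ltnS ?R0_L //; split=> //.
    by apply/R0E/GenBase; case: (x) xR.
  by move=> /bigfcupP[i _ /in_layer[_ _ _ /R0E]].
- split=> // [i|i j ij].
    apply/fset0Pn; have [i0|i_gt0] := posnP i.
      exists ([::], [::]); apply/in_layer; split=> //; exact: congr_refl.
    (* Without letters, all generating pairs would be empty words and [L] would be 0. *)
    have [a a_s] : exists a, a \in s.
      have nil_s w : s = [::] -> all (mem s) w -> size w = 0%N.
        by move=> ->; case: w.
      case Ds: s => [|a s']; last by exists a; rewrite mem_head.
      suff L0 : (L <= 0)%N by have := leq_trans i_gt0 (ltn_ord i : (i <= L)%N); rewrite ltnNge L0.
      apply/bigmax_leqP_seq => x xR _; have /andP[x1 x2] := R0_s x xR.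
      by rewrite /max_size !nil_s.
    exists (nseq i a, nseq i a); apply/in_layer.
    by rewrite /= /max_size /= size_nseq maxnn all_nseq inE a_s orbT; split=> //; exact: congr_refl.
  apply/fdisjointP => x /in_layer[_ _ xi _]; apply/negP => /in_layer[_ _ xj _].
  by case/eqP: ij; apply: val_inj; rewrite /= -xi xj.
move=> i u v /in_layer[/= u_s v_s uv_i Euv].
(* [y] plays the role of -1 in the difference of [u] and [v]. *)
have [y y1] := K_ring 1.
have uv_diff : is_difference (malg_single K u) (malg_single K v)
    (malg_single K u + y *: malg_single K v).
  by rewrite /is_difference -addrA -{2}[malg_single K v]scale1r -scalerDl addrC
     [y + 1]addrC y1 scale0r add0r.
exists (malg_single K u + y *: malg_single K v) => //.
apply: (@primitive_agree K A E K_ring E_shuffle s (E_ i) i (@E_agree i) u v) => //.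
  by rewrite -uv_i leq_maxl.
by rewrite -uv_i leq_maxr.
Qed.
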